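(* For any $d \geq 2$, $\mathsf{BT}_d$ implies $\mathsf{WKL}_0$ over $\mathsf{RCA}_0$.
   Context: Work in second order arithmetic. A graph is a pair $G=(V,E)$ with $V\subseteq\mathbb{N}$ nonempty and $E\subseteq V^2$ symmetric and irreflexive. $\delta(x)$ is the number of neighbors of $x$; for a graph of finite degree, $\Delta(G)=\max_x\delta(x)$. A $(d+1)$-clique is a set of $d+1$ pairwise adjacent vertices. A cycle is a sequence of pairwise distinct vertices $(v(i):i<n)$ with consecutive ones adjacent and $v(0)Ev(n-1)$; it is odd if $n$ is odd. ''$\chi(G)\le d$'' means $G$ has a proper $d$-coloring. $\mathsf{BT}_2$: every graph $G$ with $\Delta(G)=2$ and no odd cycles has $\chi(G)\le 2$. For $d\ge3$, $\mathsf{BT}_d$: every graph $G$ with $\Delta(G)=d$ inducing no $(d+1)$-clique has $\chi(G)\le d$. *)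

(* Defs.v *)
From Stdlib Require Import Arith.

Set Implicit Arguments.
Unset Strict Implicit.

(* Second order arithmetic is two-sorted first order logic, so a structure has
   its own numbers (possibly nonstandard) and its own collection of sets
   (possibly not all subsets).  Equality of sets is not a primitive of the
   language, hence no extensionality is imposed on [sets]. *)
Record L2structure := {
  nums : Type;
  sets : Type;
  zero : nums;
  one : nums;
  add : nums -> nums -> nums;
  mul : nums -> nums -> nums;
  lt : nums -> nums -> Prop;
  mem : nums -> sets -> Prop
}.

Arguments zero {_}.
Arguments one {_}.

Declare Scope L2_scope.
Delimit Scope L2_scope with L2.
Notation "0" := zero : L2_scope.
Notation "1" := one : L2_scope.
Notation "x + y" := (add x y) : L2_scope.
Notation "x * y" := (mul x y) : L2_scope.
Notation "x < y" := (lt x y) : L2_scope.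
Notation "x <= y" := (lt x y \/ x = y) : L2_scope.
Notation "x ∈ X" := (mem x X) (at level 70, no associativity) : L2_scope.

Local Open Scope L2_scope.

(** * Bounded quantifier formulas, Sigma^0_1 and Pi^0_1 formulas *)

(* Number variables are de Bruijn indices; set variables occur only free, as
   parameters, and are named by natural numbers. *)
Inductive term :=
| TVar (i : nat)
| TZero
| TOne
| TAdd (t u : term)
| TMul (t u : term).

Inductive bformula :=
| BEq (t u : term)
| BLt (t u : term)
| BMem (t : term) (X : nat)
| BNot (p : bformula)
| BAnd (p q : bformula)
| BOr (p q : bformula)
| BImp (p q : bformula)
| BAll (t : term) (p : bformula)
| BEx (t : term) (p : bformula).

Definition scons (A : Type) (a : A) (r : nat -> A) (i : nat) : A :=
  match i with O => a | S j => r j end.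

Fixpoint eval (M : L2structure) (r : nat -> nums M) (t : term) : nums M :=
  match t with
  | TVar i => r i
  | TZero => 0
  | TOne => 1
  | TAdd t u => eval r t + eval r u
  | TMul t u => eval r t * eval r u
  end.

(* The bound [t] of a bounded quantifier is evaluated outside the binder. *)
Fixpoint sat (M : L2structure) (s : nat -> sets M) (r : nat -> nums M)
    (p : bformula) : Prop :=
  match p with
  | BEq t u => eval r t = eval r u
  | BLt t u => eval r t < eval r u
  | BMem t X => eval r t ∈ s X
  | BNot p => ~ sat s r p
  | BAnd p q => sat s r p /\ sat s r q
  | BOr p q => sat s r p \/ sat s r q
  | BImp p q => sat s r p -> sat s r q
  | BAll t p => forall a, a < eval r t -> sat s (scons a r) p
  | BEx t p => exists a, a < eval r t /\ sat s (scons a r) p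
  end.

(* [exists m, p(m, n)] and [forall m, p(m, n)], where [m] is variable 0, [n] is
   variable 1, and the other variables are parameters. *)
Definition sigma1 (M : L2structure) (s : nat -> sets M) (r : nat -> nums M)
    (p : bformula) (n : nums M) : Prop :=
  exists m, sat s (scons m (scons n r)) p.

Definition pi1 (M : L2structure) (s : nat -> sets M) (r : nat -> nums M)
    (p : bformula) (n : nums M) : Prop :=
  forall m, sat s (scons m (scons n r)) p.

(** * The system RCA_0 *)

Record basic_axioms (M : L2structure) : Prop := {
  succ_neq_zero : forall n : nums M, n + 1 <> 0;
  succ_inj : forall m n : nums M, m + 1 = n + 1 -> m = n;
  add_zero : forall m : nums M, m + 0 = m;
  add_succ : forall m n : nums M, m + (n + 1) = (m + n) + 1;
  mul_zero : forall m : nums M, m * 0 = 0;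
  mul_succ : forall m n : nums M, m * (n + 1) = m * n + m;
  lt_zero : forall m : nums M, ~ m < 0;
  lt_succ : forall m n : nums M, m < n + 1 <-> m < n \/ m = n
}.

Definition sigma1_induction (M : L2structure) : Prop :=
  forall (s : nat -> sets M) (r : nat -> nums M) (p : bformula),
    sigma1 s r p 0 ->
    (forall n, sigma1 s r p n -> sigma1 s r p (n + 1)) ->
    forall n, sigma1 s r p n.

Definition delta1_comprehension (M : L2structure) : Prop :=
  forall (s : nat -> sets M) (r : nat -> nums M) (p q : bformula),
    (forall n, sigma1 s r p n <-> pi1 s r q n) ->
    exists X : sets M, forall n, n ∈ X <-> sigma1 s r p n.

Record RCA0 (M : L2structure) : Prop := {
  RCA0_basic : basic_axioms M;
  RCA0_induction : sigma1_induction M;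
  RCA0_comprehension : delta1_comprehension M
}.

(** * Pairs, functions and finite sequences inside a structure *)

Fixpoint numeral (M : L2structure) (n : nat) : nums M :=
  match n with O => 0 | S k => numeral M k + 1 end.

Definition pair (M : L2structure) (i j : nums M) : nums M :=
  (i + j) * (i + j) + i.

Definition maps (M : L2structure) (F : sets M) (x y : nums M) : Prop :=
  pair x y ∈ F.

Definition is_function (M : L2structure) (F : sets M)
    (D R : nums M -> Prop) : Prop :=
  (forall z, z ∈ F -> exists x y, z = pair x y /\ D x /\ R y) /\
  (forall x, D x -> exists! y, maps F x y).

Definition injective (M : L2structure) (F : sets M) : Prop :=
  forall x x' y, maps F x y -> maps F x' y -> x = x'.

(* [P] has exactly [n] elements, [n] being a number of [M]. *)
Definition has_card (M : L2structure) (P : nums M -> Prop) (n : nums M) : Prop :=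
  exists F : sets M,
    is_function F (fun i => i < n) P /\ injective F /\
    (forall y, P y -> exists i, maps F i y).

(* Simpson's coding: a finite set is coded by the least number (k, (m, n)) such
   that its elements are the i < k for which m(i+1)+1 divides n.  A number which
   is not such a triple is never a code below: it has no members, and 0, being
   (0, (0, 0)), is a smaller number with no members. *)
Definition code_mem (M : L2structure) (i c : nums M) : Prop :=
  exists k m n : nums M, c = pair k (pair m n) /\ i < k /\
    exists q, n = (m * (i + 1) + 1) * q.

Definition finset_code (M : L2structure) (c : nums M) : Prop :=
  forall c', c' < c -> ~ (forall i, code_mem i c' <-> code_mem i c).

Definition entry (M : L2structure) (s i j : nums M) : Prop :=
  code_mem (pair i j) s.

Definition has_length (M : L2structure) (s l : nums M) : Prop :=
  forall i, i < l <-> exists j, entry s i j.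

Definition seq_code (M : L2structure) (s : nums M) : Prop :=
  finset_code s /\
  (forall z, code_mem z s -> exists i j, z = pair i j) /\
  (forall i j k, entry s i j -> entry s i k -> j = k) /\
  (exists l, has_length s l).

(** * Weak Koenig's lemma *)

Definition binary_seq (M : L2structure) (s : nums M) : Prop :=
  seq_code s /\ forall i j, entry s i j -> j = 0 \/ j = 1.

Definition initial_segment (M : L2structure) (t s : nums M) : Prop :=
  forall i j, entry t i j -> entry s i j.

Definition binary_tree (M : L2structure) (T : sets M) : Prop :=
  (forall s, s ∈ T -> binary_seq s) /\
  (forall s t, s ∈ T -> seq_code t -> initial_segment t s -> t ∈ T).

Definition infinite (M : L2structure) (X : sets M) : Prop :=
  ~ exists k, forall i, i ∈ X -> i < k.

Definition path (M : L2structure) (T g : sets M) : Prop :=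
  is_function g (fun _ => True) (fun y => y = 0 \/ y = 1) /\
  forall n, exists s, s ∈ T /\ has_length s n /\
    forall i j, entry s i j -> maps g i j.

Definition WKL (M : L2structure) : Prop :=
  forall T : sets M, binary_tree T -> infinite T -> exists g, path T g.

Definition WKL0 (M : L2structure) : Prop := RCA0 M /\ WKL M.

(** * Graphs and Brooks' theorem *)

Definition adj (M : L2structure) (E : sets M) (x y : nums M) : Prop :=
  pair x y ∈ E.

Definition is_graph (M : L2structure) (V E : sets M) : Prop :=
  (exists x, x ∈ V) /\
  (forall z, z ∈ E -> exists x y, z = pair x y /\ x ∈ V /\ y ∈ V) /\
  (forall x y, adj E x y -> adj E y x) /\
  (forall x, ~ adj E x x).

Definition degree (M : L2structure) (E : sets M) (x n : nums M) : Prop :=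
  has_card (adj E x) n.

(* Every vertex has finite degree and the maximum of the degrees is [d]. *)
Definition max_degree (M : L2structure) (V E : sets M) (d : nums M) : Prop :=
  (forall x, x ∈ V -> exists n, degree E x n /\ n <= d) /\
  (exists x, x ∈ V /\ degree E x d).

Definition has_clique (M : L2structure) (V E : sets M) (n : nums M) : Prop :=
  exists C : sets M,
    (forall x, x ∈ C -> x ∈ V) /\
    (forall x y, x ∈ C -> y ∈ C -> x <> y -> adj E x y) /\
    has_card (fun x => x ∈ C) n.

(* The last vertex v(n-1) is v(k) for the [k] with [n = k + 1]. *)
Definition is_cycle (M : L2structure) (V E v : sets M) (n : nums M) : Prop :=
  is_function v (fun i => i < n) (fun x => x ∈ V) /\
  injective v /\
  (forall i x y, maps v i x -> maps v (i + 1) y -> adj E x y) /\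
  (exists k x y, n = k + 1 /\ maps v 0 x /\ maps v k y /\ adj E x y).

Definition odd (M : L2structure) (n : nums M) : Prop :=
  exists k, n = (1 + 1) * k + 1.

Definition has_odd_cycle (M : L2structure) (V E : sets M) : Prop :=
  exists (v : sets M) (n : nums M), odd n /\ is_cycle V E v n.

Definition colorable (M : L2structure) (V E : sets M) (d : nums M) : Prop :=
  exists c : sets M,
    is_function c (fun x => x ∈ V) (fun i => i < d) /\
    forall x y i j, adj E x y -> maps c x i -> maps c y j -> i <> j.

Definition BT_two (M : L2structure) : Prop :=
  forall V E : sets M, is_graph V E -> max_degree V E (numeral M 2) ->
    ~ has_odd_cycle V E -> colorable V E (numeral M 2).

Definition BT_clique (d : nat) (M : L2structure) : Prop :=
  forall V E : sets M, is_graph V E -> max_degree V E (numeral M d) ->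
    ~ has_clique V E (numeral M (S d)) -> colorable V E (numeral M d).

(* Only meaningful for [d >= 2]. *)
Definition BT (d : nat) (M : L2structure) : Prop :=
  if Nat.eqb d 2 then BT_two M else BT_clique d M.

(** * Implication between principles over a base system *)

(* [P] implies [Q] over [T]: every model of [T] satisfying [P] satisfies [Q].
   Models are arbitrary two-sorted structures, so by Goedel's completeness
   theorem this is provability of [Q] from [T] together with [P]. *)
Definition implies_over (T P Q : L2structure -> Prop) : Prop :=
  forall M : L2structure, T M -> P M -> Q M.

(* Main.v *)
(** Two disjoint enumerations [X], [Y] are separated by a graph in which each [n] has
    two end vertices, present from the start.  Neighbour sets need not be computable,
    so when [n] is enumerated at stage [m] new vertices can still be attached to the
    ends: they form a clique large enough that in every [d]-colouring the ends get
    equal colours if [n] goes into [X] and different ones if it goes into [Y].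
    Outside the model there is a proper [d]-colouring, which excludes large cliques;
    on a single component it is definable, which excludes odd cycles of any
    (possibly nonstandard) length.

    Separation yields a path through an infinite binary tree: at [t], separate the
    case that the extension by 1 dies out first from the case that the extension by 0
    does, and follow the answers. *)

From Stdlib Require Import Arith List Lia Classical Ring FinFun.
Require Import Defs.
Import ListNotations.

Local Open Scope L2_scope.

(** * Definability *)

(** Every set used has to come from a formula, so definability is treated as a closure property of
    predicates on environments and then discharged by tactics. The stage is part of the name of a
    vertex, which makes adjacency a bounded condition although nobody can compute the neighbours of
    an end. Repeated enumeration of one number would attach further cliques to its ends and destroy
    the degree bound, so only first stages are kept. The sizes [d] and [d + 1] are standard, hence
    degrees, cliques and colours are counted outside the model. In the tree argument, being
    extendible to every level is a Pi^0_1 condition; it becomes manageable through an explicit bound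
    on the codes of binary sequences of given length and through Pi^0_1 induction. *)

Fixpoint trename (f : nat -> nat) (t : term) : term :=
  match t with
  | TVar i => TVar (f i)
  | TZero => TZero
  | TOne => TOne
  | TAdd t u => TAdd (trename f t) (trename f u)
  | TMul t u => TMul (trename f t) (trename f u)
  end.

Definition up (f : nat -> nat) (i : nat) : nat :=
  match i with O => O | S j => S (f j) end.

(* [f] renames number variables and [g] set variables. *)
Fixpoint rename (f g : nat -> nat) (p : bformula) : bformula :=
  match p with
  | BEq t u => BEq (trename f t) (trename f u)
  | BLt t u => BLt (trename f t) (trename f u)
  | BMem t X => BMem (trename f t) (g X)
  | BNot p => BNot (rename f g p)
  | BAnd p q => BAnd (rename f g p) (rename f g q)
  | BOr p q => BOr (rename f g p) (rename f g q)
  | BImp p q => BImp (rename f g p) (rename f g q)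
  | BAll t p => BAll (trename f t) (rename (up f) g p)
  | BEx t p => BEx (trename f t) (rename (up f) g p)
  end.

Definition merge {A : Type} (u v : nat -> A) (i : nat) : A :=
  if Nat.even i then u (Nat.div2 i) else v (Nat.div2 i).

Definition inl_index (i : nat) : nat := 2 * i.
Definition inr_index (i : nat) : nat := S (2 * i).

Lemma merge_l {A} (u v : nat -> A) i : merge u v (inl_index i) = u i.
Proof.
  unfold merge, inl_index. rewrite Nat.even_even, Nat.div2_double. reflexivity.
Qed.

Lemma merge_r {A} (u v : nat -> A) i : merge u v (inr_index i) = v i.
Proof.
  unfold merge, inr_index.
  replace (S (2 * i)) with (2 * i + 1)%nat by lia.
  rewrite Nat.even_odd. replace (2 * i + 1)%nat with (S (2 * i)) by lia.
  rewrite Nat.div2_succ_double. reflexivity.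
Qed.

(* A structure without sets satisfies [sigma1_induction] and
   [delta1_comprehension] vacuously, since both quantify over [nat -> sets M]. *)
Class model (M : L2structure) : Prop := {
  model_RCA0 : RCA0 M;
  model_set : inhabited (sets M)
}.

Section Definability.
Context {M : L2structure} {HM : model M}.
Notation env := (nat -> nums M).

Lemma eval_ext (r r' : env) t : (forall i, r i = r' i) -> eval r t = eval r' t.
Proof. intros H. induction t; simpl; congruence. Qed.

Lemma eval_rename (r : env) f t : eval r (trename f t) = eval (fun i => r (f i)) t.
Proof. induction t; simpl; congruence. Qed.

Lemma sat_ext s s' p : forall r r' : env, (forall i, s i = s' i) ->
  (forall i, r i = r' i) -> (sat s r p <-> sat s' r' p).
Proof.
  induction p; intros r r' Hs Hr; simpl.
  - rewrite !(eval_ext _ _ _ Hr). tauto.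
  - rewrite !(eval_ext _ _ _ Hr). tauto.
  - rewrite !(eval_ext _ _ _ Hr), Hs. tauto.
  - rewrite (IHp _ _ Hs Hr). tauto.
  - rewrite (IHp1 _ _ Hs Hr), (IHp2 _ _ Hs Hr). tauto.
  - rewrite (IHp1 _ _ Hs Hr), (IHp2 _ _ Hs Hr). tauto.
  - rewrite (IHp1 _ _ Hs Hr), (IHp2 _ _ Hs Hr). tauto.
  - rewrite (eval_ext _ _ _ Hr).
    assert (H : forall a, sat s (scons a r) p <-> sat s' (scons a r') p).
    { intros a. apply IHp; auto. intros [|i]; simpl; auto. }
    split; intros K a Ha; apply H; auto.
  - rewrite (eval_ext _ _ _ Hr).
    assert (H : forall a, sat s (scons a r) p <-> sat s' (scons a r') p).
    { intros a. apply IHp; auto. intros [|i]; simpl; auto. }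
    split; intros [a [Ha K]]; exists a; split; auto; apply H; auto.
Qed.

Lemma sat_rename s g p : forall (r : env) f,
  sat s r (rename f g p) <-> sat (fun i => s (g i)) (fun i => r (f i)) p.
Proof.
  induction p; intros r f; simpl; rewrite ?eval_rename.
  - tauto.
  - tauto.
  - tauto.
  - rewrite IHp. tauto.
  - rewrite IHp1, IHp2. tauto.
  - rewrite IHp1, IHp2. tauto.
  - rewrite IHp1, IHp2. tauto.
  - assert (H : forall a, sat s (scons a r) (rename (up f) g p) <->
              sat (fun i => s (g i)) (scons a (fun i => r (f i))) p).
    { intros a. rewrite IHp. apply sat_ext; auto. intros [|i]; reflexivity. }
    split; intros K a Ha; apply H; auto.
  - assert (H : forall a, sat s (scons a r) (rename (up f) g p) <->
              sat (fun i => s (g i)) (scons a (fun i => r (f i))) p).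
    { intros a. rewrite IHp. apply sat_ext; auto. intros [|i]; reflexivity. }
    split; intros [a [Ha K]]; exists a; split; auto; apply H; auto.
Qed.

(* Variables with an even index are the visible ones; those with an odd index
   hold number parameters [c], so that elements of [M] may be used as constants. *)
Definition Tm (f : env -> nums M) : Prop :=
  exists (c : env) t, forall r, eval (merge r c) t = f r.

Definition D0 (P : env -> Prop) : Prop :=
  exists (s : nat -> sets M) (c : env) p,
    forall r, sat s (merge r c) p <-> P r.

(** Two formulas to be combined bring their own parameters [c] and [c']. These are interleaved into
    one environment; visible variables keep their places and each parameter moves to its new one. *)
Definition inl_params (i : nat) : nat :=
  if Nat.even i then i else inr_index (inl_index (Nat.div2 i)).
Definition inr_params (i : nat) : nat :=
  if Nat.even i then i else inr_index (inr_index (Nat.div2 i)).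

Lemma even_half i : Nat.even i = true -> i = inl_index (Nat.div2 i).
Proof.
  intros H. unfold inl_index.
  rewrite (Nat.div2_odd i) at 1. rewrite <- Nat.negb_even, H. simpl. lia.
Qed.

Lemma odd_half i : Nat.even i = false -> i = inr_index (Nat.div2 i).
Proof.
  intros H. unfold inr_index.
  rewrite (Nat.div2_odd i) at 1. rewrite <- Nat.negb_even, H. simpl. lia.
Qed.

Lemma merge_inl_params (r c c' : env) i :
  merge r (merge c c') (inl_params i) = merge r c i.
Proof.
  unfold inl_params. destruct (Nat.even i) eqn:E.
  - rewrite (even_half _ E). rewrite !merge_l. reflexivity.
  - rewrite merge_r, merge_l. rewrite (odd_half _ E) at 2. rewrite merge_r.
    reflexivity.
Qed.

Lemma merge_inr_params (r c c' : env) i :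
  merge r (merge c c') (inr_params i) = merge r c' i.
Proof.
  unfold inr_params. destruct (Nat.even i) eqn:E.
  - rewrite (even_half _ E). rewrite !merge_l. reflexivity.
  - rewrite !merge_r. rewrite (odd_half _ E) at 2. rewrite merge_r.
    reflexivity.
Qed.

Lemma Tm_var i : Tm (fun r => r i).
Proof.
  exists (fun _ => 0), (TVar (inl_index i)). intros r. apply merge_l.
Qed.

Lemma Tm_cst a : Tm (fun _ => a).
Proof.
  exists (fun _ => a), (TVar (inr_index 0)). intros r. simpl. apply merge_r.
Qed.

Lemma Tm_pair2 f g : Tm f -> Tm g -> exists c t u,
  forall r, eval (merge r c) t = f r /\ eval (merge r c) u = g r.
Proof.
  intros [c [t Ht]] [c' [u Hu]].
  exists (merge c c'), (trename inl_params t), (trename inr_params u). intros r.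
  rewrite !eval_rename. split.
  - rewrite <- Ht. apply eval_ext. apply merge_inl_params.
  - rewrite <- Hu. apply eval_ext. apply merge_inr_params.
Qed.

Lemma Tm_add f g : Tm f -> Tm g -> Tm (fun r => f r + g r).
Proof.
  intros Hf Hg. destruct (Tm_pair2 _ _ Hf Hg) as [c [t [u H]]].
  exists c, (TAdd t u). intros r. simpl. destruct (H r). congruence.
Qed.

Lemma Tm_mul f g : Tm f -> Tm g -> Tm (fun r => f r * g r).
Proof.
  intros Hf Hg. destruct (Tm_pair2 _ _ Hf Hg) as [c [t [u H]]].
  exists c, (TMul t u). intros r. simpl. destruct (H r). congruence.
Qed.

Lemma Tm_pair f g : Tm f -> Tm g -> Tm (fun r => pair (f r) (g r)).
Proof. intros Hf Hg. unfold pair. auto using Tm_add, Tm_mul. Qed.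

Lemma D0_ext P Q : (forall r, P r <-> Q r) -> D0 Q -> D0 P.
Proof.
  intros H [s [c [p Hp]]]. exists s, c, p. intros r. rewrite Hp, H. tauto.
Qed.

Lemma D0_eq f g : Tm f -> Tm g -> D0 (fun r => f r = g r).
Proof.
  intros Hf Hg. destruct (Tm_pair2 _ _ Hf Hg) as [c [t [u H]]].
  destruct HM as [_ [X]]. exists (fun _ => X), c, (BEq t u).
  intros r. simpl. destruct (H r) as [-> ->]. tauto.
Qed.

Lemma D0_lt f g : Tm f -> Tm g -> D0 (fun r => f r < g r).
Proof.
  intros Hf Hg. destruct (Tm_pair2 _ _ Hf Hg) as [c [t [u H]]].
  destruct HM as [_ [X]]. exists (fun _ => X), c, (BLt t u).
  intros r. simpl. destruct (H r) as [-> ->]. tauto.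
Qed.

Lemma D0_mem f X : Tm f -> D0 (fun r => f r ∈ X).
Proof.
  intros [c [t H]]. exists (fun _ => X), c, (BMem t 0).
  intros r. simpl. rewrite H. tauto.
Qed.

Lemma D0_not P : D0 P -> D0 (fun r => ~ P r).
Proof.
  intros [s [c [p H]]]. exists s, c, (BNot p). intros r. simpl.
  rewrite H. tauto.
Qed.

Lemma D0_pair2 P Q : D0 P -> D0 Q -> exists s c p q,
  forall r, (sat s (merge r c) p <-> P r) /\ (sat s (merge r c) q <-> Q r).
Proof.
  intros [s [c [p Hp]]] [s' [c' [q Hq]]].
  exists (merge s s'), (merge c c'), (rename inl_params inl_index p),
    (rename inr_params inr_index q).
  intros r. rewrite !sat_rename, <- Hp, <- Hq. split.
  - apply sat_ext; intros i; [apply merge_l | apply merge_inl_params].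
  - apply sat_ext; intros i; [apply merge_r | apply merge_inr_params].
Qed.

Lemma D0_and P Q : D0 P -> D0 Q -> D0 (fun r => P r /\ Q r).
Proof.
  intros HP HQ. destruct (D0_pair2 _ _ HP HQ) as [s [c [p [q H]]]].
  exists s, c, (BAnd p q). intros r. simpl. destruct (H r). tauto.
Qed.

Lemma D0_or P Q : D0 P -> D0 Q -> D0 (fun r => P r \/ Q r).
Proof.
  intros HP HQ. destruct (D0_pair2 _ _ HP HQ) as [s [c [p [q H]]]].
  exists s, c, (BOr p q). intros r. simpl. destruct (H r). tauto.
Qed.

Lemma D0_imp P Q : D0 P -> D0 Q -> D0 (fun r => P r -> Q r).
Proof.
  intros HP HQ. destruct (D0_pair2 _ _ HP HQ) as [s [c [p [q H]]]].
  exists s, c, (BImp p q). intros r. simpl. destruct (H r). tauto.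
Qed.

(** By excluded middle a closed proposition of any complexity is equivalent to a true or to a false
    equation. This lets facts about fixed parameters, such as an unbounded search for one [n], enter
    a bounded formula. *)
Lemma D0_cst (A : Prop) : D0 (fun _ => A).
Proof.
  destruct (classic A) as [HA|HA].
  - apply (D0_ext _ (fun _ => (0 : nums M) = 0)); [tauto | apply D0_eq; apply Tm_cst].
  - apply (D0_ext _ (fun _ => ~ (0 : nums M) = 0)); [tauto |].
    apply D0_not, D0_eq; apply Tm_cst.
Qed.

(** A quantifier puts its value in front of visible variables and parameters alike, whereas the
    merged layout expects it as visible variable 0. The remaining indices are shifted
    accordingly. *)
Definition bind_params (i : nat) : nat :=
  if Nat.even i then match Nat.div2 i with O => O | S j => S (inl_index j) end
  else S i.

Lemma merge_bind (r c : env) a i :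
  scons a (merge r c) (bind_params i) = merge (scons a r) c i.
Proof.
  unfold bind_params. destruct (Nat.even i) eqn:E.
  - rewrite (even_half _ E) at 2. rewrite merge_l.
    destruct (Nat.div2 i); [reflexivity|]. simpl scons. apply merge_l.
  - simpl scons. rewrite (odd_half _ E), !merge_r. reflexivity.
Qed.

Lemma D0_bind f (P : nums M -> env -> Prop) :
  Tm f -> D0 (fun r => P (r O) (fun i => r (S i))) -> exists s c t p,
  forall r, eval (merge r c) t = f r /\
    forall a, sat s (scons a (merge r c)) p <-> P a r.
Proof.
  intros Hf HP.
  assert (HP' : exists s c p, forall r a,
    sat s (merge (scons a r) c) p <-> P a r).
  { destruct HP as [s [c [p H]]]. exists s, c, p. intros r a. apply H. }
  destruct HP' as [s [c [p Hp]]]. destruct Hf as [c' [t Ht]].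
  exists s, (merge c c'), (trename inr_params t),
    (rename (fun i => bind_params (inl_params i)) (fun i => i) p).
  intros r. split.
  - rewrite eval_rename, <- Ht. apply eval_ext, merge_inr_params.
  - intros a. rewrite sat_rename, <- Hp. apply sat_ext; [reflexivity|].
    intros i. rewrite merge_bind. apply merge_inl_params.
Qed.

Lemma D0_ex f (P : nums M -> env -> Prop) :
  Tm f -> D0 (fun r => P (r O) (fun i => r (S i))) ->
  D0 (fun r => exists a, a < f r /\ P a r).
Proof.
  intros Hf HP. destruct (D0_bind _ _ Hf HP) as [s [c [t [p H]]]].
  exists s, c, (BEx t p). intros r. simpl. destruct (H r) as [-> K].
  split; intros [a [Ha Hb]]; exists a; split; auto; apply K; auto.
Qed.

Lemma D0_all f (P : nums M -> env -> Prop) :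
  Tm f -> D0 (fun r => P (r O) (fun i => r (S i))) ->
  D0 (fun r => forall a, a < f r -> P a r).
Proof.
  intros Hf HP. destruct (D0_bind _ _ Hf HP) as [s [c [t [p H]]]].
  exists s, c, (BAll t p). intros r. simpl. destruct (H r) as [-> K].
  split; intros L a Ha; apply K; auto.
Qed.

(** * Sigma^0_1 predicates, their induction and Delta^0_1 comprehension *)

Definition S1 (P : env -> Prop) : Prop :=
  exists Q : nums M -> env -> Prop,
    D0 (fun r => Q (r O) (fun i => r (S i))) /\
    forall r, P r <-> exists m, Q m r.

Lemma S1_ext P Q : (forall r, P r <-> Q r) -> S1 Q -> S1 P.
Proof.
  intros H [R [HR K]]. exists R. split; auto. intros r. rewrite H. auto.
Qed.

Lemma Tm_subst_S f : Tm f -> Tm (fun r => f (fun i => r (S i))).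
Proof.
  intros [c [t Ht]]. exists c.
  exists (trename (fun i => if Nat.even i then S (S i) else i) t). intros r.
  rewrite eval_rename, <- Ht. apply eval_ext. intros i. unfold merge.
  destruct (Nat.even i) eqn:E; [|rewrite E]; simpl; rewrite ?E; reflexivity.
Qed.

Lemma D0_subst P (g : env -> env) (f : nat -> nat) :
  (forall r i, g r i = r (f i)) -> D0 P -> D0 (fun r => P (g r)).
Proof.
  intros Hg [s [c [p Hp]]].
  exists s, c, (rename (fun i => if Nat.even i then inl_index (f (Nat.div2 i))
                          else i) (fun i => i) p).
  intros r. rewrite sat_rename, <- Hp. apply sat_ext; [reflexivity|].
  intros i. unfold merge at 2. destruct (Nat.even i) eqn:E.
  - rewrite merge_l, Hg. reflexivity.
  - rewrite (odd_half _ E) at 1. apply merge_r.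
Qed.

Lemma S1_ex_D0 (P : nums M -> env -> Prop) :
  D0 (fun r => P (r O) (fun i => r (S i))) -> S1 (fun r => exists a, P a r).
Proof. intros H. exists P. split; [exact H | tauto]. Qed.

Lemma S1_D0 P : D0 P -> S1 P.
Proof.
  intros H. exists (fun _ => P). split.
  - apply (D0_subst P _ S); auto.
  - intros r. split; [exists 0; auto | intros [_ K]; auto].
Qed.

(* Merging the parameters into the environment turns [m], [n] into the first two
   variables, as in the definitions of [sigma1] and [pi1]. *)
Lemma S1_pair2_sigma1 (P Q : nums M -> Prop) :
  S1 (fun r => P (r O)) -> S1 (fun r => Q (r O)) -> exists s r p q,
  forall n, (P n <-> sigma1 s r p n) /\ (Q n <-> sigma1 s r q n).
Proof.
  intros [P' [HP HP']] [Q' [HQ HQ']].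
  destruct (D0_pair2 _ _ HP HQ) as [s [c [p [q H]]]].
  (* Visible variable 0 is the witness, and all later visible variables are read as [n], since the
     environment is constant from there on. The parameters move behind these two. *)
  set (f i := if Nat.even i then Nat.min (Nat.div2 i) 1 else S (S (Nat.div2 i))).
  exists s, c, (rename f (fun i => i) p), (rename f (fun i => i) q).
  intros n.
  assert (E : forall m t, sat s (scons m (scons n c)) (rename f (fun i => i) t) <->
                     sat s (merge (scons m (fun _ => n)) c) t).
  { intros m t. rewrite sat_rename. apply sat_ext; [reflexivity|].
    intros i. unfold merge, f. destruct (Nat.even i); [|reflexivity].
    destruct (Nat.div2 i) as [|[|j]]; reflexivity. }
  rewrite (HP' (fun _ => n)), (HQ' (fun _ => n)). unfold sigma1.
  split; split; intros [m Hm]; exists m; specialize (H (scons m (fun _ => n)));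
    [apply E, H | apply H, E | apply E, H | apply H, E]; auto.
Qed.

Lemma S1_induction (P : nums M -> Prop) : S1 (fun r => P (r O)) ->
  P 0 -> (forall n, P n -> P (n + 1)) -> forall n, P n.
Proof.
  intros HP H0 HS n. destruct (S1_pair2_sigma1 _ _ HP HP) as [s [r [p [q H]]]].
  apply H. apply (RCA0_induction model_RCA0).
  - apply H, H0.
  - intros k Hk. apply H, HS, H, Hk.
Qed.

Lemma D0_induction (P : nums M -> Prop) : D0 (fun r => P (r O)) ->
  P 0 -> (forall n, P n -> P (n + 1)) -> forall n, P n.
Proof. intros H. apply S1_induction, S1_D0, H. Qed.

(** The negated matrix of the complement supplies the Pi^0_1 form that [delta1_comprehension] asks
    for. *)
Lemma S1_comprehension (P : nums M -> Prop) :
  S1 (fun r => P (r O)) -> S1 (fun r => ~ P (r O)) ->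
  exists X : sets M, forall n, n ∈ X <-> P n.
Proof.
  intros HP HN.
  destruct (S1_pair2_sigma1 _ (fun n => ~ P n) HP HN) as [s [r [p [q H]]]].
  destruct (@RCA0_comprehension M model_RCA0 s r p (BNot q)) as [X HX].
  - intros n. destruct (H n) as [Hp Hq]. rewrite <- Hp. split.
    + intros K m Hm. apply Hq; [exists m |]; auto.
    + intros K. apply NNPP. intros L. apply Hq in L. destruct L as [m Hm].
      apply (K m), Hm.
  - exists X. intros n. rewrite HX. symmetry. apply H.
Qed.

Lemma D0_comprehension (P : nums M -> Prop) :
  D0 (fun r => P (r O)) -> exists X : sets M, forall n, n ∈ X <-> P n.
Proof.
  intros H. apply S1_comprehension; apply S1_D0; auto using D0_not.
Qed.

End Definability.

(** * Arithmetic *)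

Ltac tm := repeat first
  [ apply Tm_var | apply Tm_cst | apply Tm_add | apply Tm_mul | apply Tm_pair ].

Create HintDb d0.

Ltac d0 := repeat (cbv beta; first
  [ apply D0_cst | solve [auto 1 with d0]
  | apply D0_eq; solve [tm] | apply D0_lt; solve [tm]
  | apply D0_mem; solve [tm] | apply D0_and | apply D0_or | apply D0_not
  | (apply D0_ex; [solve [tm]|]) | (apply D0_all; [solve [tm]|])
  | apply D0_imp ]).

(* Plain [apply] may guess a wrong motive when the goal is an implication. *)
Ltac d0_induction :=
  match goal with |- forall n, @?P n => apply (D0_induction P); cbv beta end.
Ltac s1_induction :=
  match goal with |- forall n, @?P n => apply (S1_induction P); cbv beta end.

Section Arithmetic.
Context {M : L2structure} {HM : model M}.
Implicit Types x y z : nums M.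

Lemma model_basic : basic_axioms M.
Proof. apply (RCA0_basic model_RCA0). Qed.

Lemma add_0_r x : x + 0 = x. Proof. apply (add_zero model_basic). Qed.
Lemma add_S_r x y : x + (y + 1) = (x + y) + 1. Proof. apply (add_succ model_basic). Qed.
Lemma mul_0_r x : x * 0 = 0. Proof. apply (mul_zero model_basic). Qed.
Lemma mul_S_r x y : x * (y + 1) = x * y + x. Proof. apply (mul_succ model_basic). Qed.

Lemma add_assoc x y z : x + (y + z) = (x + y) + z.
Proof.
  revert z. d0_induction; [d0| |].
  - rewrite !add_0_r. reflexivity.
  - intros z IH. rewrite !add_S_r, IH. reflexivity.
Qed.

Lemma add_0_l x : 0 + x = x.
Proof.
  revert x. d0_induction; [d0| |].
  - apply add_0_r.
  - intros x IH. rewrite add_assoc, IH. reflexivity.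
Qed.

Lemma add_1_comm x : x + 1 = 1 + x.
Proof.
  revert x. d0_induction; [d0| |].
  - rewrite add_0_l, add_0_r. reflexivity.
  - intros x IH. rewrite IH at 1. rewrite add_assoc. reflexivity.
Qed.

Lemma add_comm x y : x + y = y + x.
Proof.
  revert y. d0_induction; [d0| |].
  - rewrite add_0_l, add_0_r. reflexivity.
  - intros y IH. rewrite add_assoc, IH, <- add_assoc, add_1_comm, add_assoc.
    reflexivity.
Qed.

Lemma mul_1_r x : x * 1 = x.
Proof. rewrite <- (add_0_l 1), mul_S_r, mul_0_r. apply add_0_l. Qed.

Lemma mul_0_l x : 0 * x = 0.
Proof.
  revert x. d0_induction; [d0| |].
  - apply mul_0_r.
  - intros x IH. rewrite mul_S_r, IH. apply add_0_r.
Qed.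

Lemma mul_S_l x y : (x + 1) * y = x * y + y.
Proof.
  revert y. d0_induction; [d0| |].
  - rewrite !mul_0_r, add_0_r. reflexivity.
  - intros y IH. rewrite !mul_S_r, IH, !add_S_r. f_equal.
    rewrite <- !add_assoc. f_equal. apply add_comm.
Qed.

Lemma mul_comm x y : x * y = y * x.
Proof.
  revert y. d0_induction; [d0| |].
  - rewrite mul_0_l, mul_0_r. reflexivity.
  - intros y IH. rewrite mul_S_r, mul_S_l, IH. reflexivity.
Qed.

Lemma mul_add_distr_l x y z : x * (y + z) = x * y + x * z.
Proof.
  revert z. d0_induction; [d0| |].
  - rewrite mul_0_r, !add_0_r. reflexivity.
  - intros z IH. rewrite add_S_r, !mul_S_r, IH, add_assoc. reflexivity.
Qed.

Lemma mul_assoc x y z : x * (y * z) = (x * y) * z.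
Proof.
  revert z. d0_induction; [d0| |].
  - rewrite !mul_0_r. reflexivity.
  - intros z IH. rewrite !mul_S_r, mul_add_distr_l, IH. reflexivity.
Qed.

Lemma nums_semiring : semi_ring_theory (0 : nums M) 1 (@add M) (@mul M) eq.
Proof.
  constructor.
  - apply add_0_l.
  - apply add_comm.
  - apply add_assoc.
  - intros x. rewrite mul_comm. apply mul_1_r.
  - apply mul_0_l.
  - apply mul_comm.
  - apply mul_assoc.
  - intros x y z. rewrite !(mul_comm _ z). apply mul_add_distr_l.
Qed.

Add Ring nums_ring : nums_semiring.

Lemma lt_irrefl_0 x : ~ x < 0. Proof. apply (lt_zero model_basic). Qed.
Lemma lt_S_iff x y : x < y + 1 <-> x < y \/ x = y. Proof. apply (lt_succ model_basic). Qed.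

Lemma lt_iff_add x y : x < y <-> exists z, y = x + z + 1.
Proof.
  split.
  (* The difference is an unbounded witness at this point, hence Sigma^0_1 induction. The premise
     stands inside the existential quantifier so that the matrix is bounded. *)
  - intros H. enough (K : forall y, exists z, x < y -> y = x + z + 1).
    { destruct (K y) as [z Hz]. eauto. }
    clear y H. s1_induction; [apply S1_ex_D0; d0| |].
    + exists 0. intros H. destruct (lt_irrefl_0 _ H).
    + intros y [z Hz]. destruct (classic (x < y)) as [H|H].
      * exists (z + 1). intros _. rewrite (Hz H) at 1. ring.
      * exists 0. intros K. apply lt_S_iff in K. destruct K as [K| ->]; [tauto|].
        ring.
  - intros [z ->]. revert z. d0_induction; [d0| |].
    + apply lt_S_iff. right. ring.
    + intros z IH. apply lt_S_iff. left. replace (x + (z + 1)) with (x + z + 1) by ring.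
      exact IH.
Qed.

Lemma le_iff_add x y : x <= y <-> exists z, y = x + z.
Proof.
  rewrite <- lt_S_iff, lt_iff_add. split; intros [z Hz]; exists z.
  - apply (succ_inj model_basic), Hz.
  - rewrite Hz. ring.
Qed.

Lemma zero_or_succ x : x = 0 \/ exists y, x = y + 1.
Proof.
  enough (exists y, x <> 0 -> x = y + 1).
  { destruct H as [y Hy]. destruct (classic (x = 0)); eauto. }
  revert x. s1_induction; [apply S1_ex_D0; d0| |].
  - exists 0. tauto.
  - intros x _. exists x. auto.
Qed.

Lemma lt_total x y : x < y \/ x = y \/ y < x.
Proof.
  revert x. d0_induction; [d0| |].
  - destruct (zero_or_succ y) as [-> | [z ->]]; [auto|].
    left. apply lt_iff_add. exists z. ring.
  - intros x [H|[->|H]].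
    + apply lt_iff_add in H. destruct H as [z ->].
      destruct (zero_or_succ z) as [->|[w ->]].
      * right; left. ring.
      * left. apply lt_iff_add. exists w. ring.
    + right; right. apply lt_S_iff. auto.
    + right; right. apply lt_S_iff. auto.
Qed.

Lemma add_cancel_r x y z : x + z = y + z -> x = y.
Proof.
  revert z. d0_induction; [d0| |].
  - rewrite !add_0_r. auto.
  - intros z IH H. rewrite !add_S_r in H. apply IH, (succ_inj model_basic), H.
Qed.

Lemma add_cancel_l x y z : z + x = z + y -> x = y.
Proof. rewrite !(add_comm z). apply add_cancel_r. Qed.

Lemma lt_irrefl x : ~ x < x.
Proof.
  intros H. apply lt_iff_add in H. destruct H as [z Hz].
  apply (@succ_neq_zero M model_basic z), (add_cancel_l _ _ x). rewrite Hz at 2. ring.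
Qed.

Lemma lt_trans x y z : x < y -> y < z -> x < z.
Proof.
  rewrite !lt_iff_add. intros [u ->] [v ->]. exists (u + v + 1). ring.
Qed.

Lemma le_lt_trans x y z : x <= y -> y < z -> x < z.
Proof. intros [H| ->]; eauto using lt_trans. Qed.

Lemma lt_le_trans x y z : x < y -> y <= z -> x < z.
Proof. intros H [K| <-]; eauto using lt_trans. Qed.

Lemma le_trans x y z : x <= y -> y <= z -> x <= z.
Proof. intros H [K| <-]; [left|]; eauto using le_lt_trans. Qed.

Lemma le_not_lt x y : x <= y <-> ~ y < x.
Proof.
  split.
  - intros H K. apply (lt_irrefl x). eauto using le_lt_trans.
  - intros H. destruct (lt_total x y) as [|[|]]; tauto.
Qed.

Lemma not_le_lt x y : ~ x <= y <-> y < x.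
Proof. rewrite le_not_lt. split; [apply NNPP | tauto]. Qed.

Lemma le_0_l x : 0 <= x.
Proof. apply le_iff_add. exists x. ring. Qed.

Lemma le_add_r x y : x <= x + y.
Proof. apply le_iff_add. eauto. Qed.

Lemma le_add_l x y : x <= y + x.
Proof. apply le_iff_add. exists y. ring. Qed.

Lemma lt_succ_diag x : x < x + 1.
Proof. apply lt_S_iff. auto. Qed.

Lemma lt_le_succ x y : x < y <-> x + 1 <= y.
Proof.
  rewrite lt_iff_add, le_iff_add. split; intros [z ->]; exists z; ring.
Qed.

Lemma add_le_mono x y z w : x <= y -> z <= w -> x + z <= y + w.
Proof.
  rewrite !le_iff_add. intros [u ->] [v ->]. exists (u + v). ring.
Qed.

Lemma mul_le_mono x y z w : x <= y -> z <= w -> x * z <= y * w.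
Proof.
  rewrite !le_iff_add. intros [u ->] [v ->]. exists (x * v + u * z + u * v). ring.
Qed.

Lemma mul_eq_0 x y : x * y = 0 -> x = 0 \/ y = 0.
Proof.
  destruct (zero_or_succ x) as [->|[u ->]]; [auto|].
  destruct (zero_or_succ y) as [->|[v ->]]; [auto|].
  intros H. exfalso. apply (@succ_neq_zero M model_basic (u * v + u + v)). rewrite <- H. ring.
Qed.

(** Pairs are ordered first by their sums, since [i <= i + j] keeps [pair i j] below the square of
    [i + j + 1]. *)
Lemma pair_lt_aux (i j i' j' : nums M) : i + j < i' + j' -> pair i j < pair i' j'.
Proof.
  intros H. apply lt_iff_add in H. destruct H as [u H].
  unfold pair. rewrite H. apply lt_iff_add.
  exists ((i + j) * (u + 1) + j + u * (i + j + u + 1) + u + i').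
  ring.
Qed.

Lemma pair_inj (i j i' j' : nums M) : pair i j = pair i' j' -> i = i' /\ j = j'.
Proof.
  intros H. destruct (lt_total (i + j) (i' + j')) as [K|[K|K]].
  - apply pair_lt_aux in K. rewrite H in K. destruct (lt_irrefl _ K).
  - unfold pair in H. rewrite K in H. apply add_cancel_l in H. subst i'.
    apply add_cancel_l in K. auto.
  - apply pair_lt_aux in K. rewrite H in K. destruct (lt_irrefl _ K).
Qed.

Lemma le_square x : x <= x * x.
Proof.
  destruct (zero_or_succ x) as [->|[y ->]].
  - right. ring.
  - apply le_iff_add. exists (y * y + y). ring.
Qed.

Lemma le_pair_l (i j : nums M) : i <= pair i j.
Proof. unfold pair. apply le_add_l. Qed.

Lemma le_pair_r (i j : nums M) : j <= pair i j.
Proof.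
  unfold pair. eapply le_trans; [|apply le_add_r].
  eapply le_trans; [|apply le_square]. apply le_add_l.
Qed.

Lemma pair_mono (i j i' j' : nums M) : i <= i' -> j <= j' -> pair i j <= pair i' j'.
Proof.
  intros Hi Hj. unfold pair. auto using add_le_mono, mul_le_mono.
Qed.

Notation env := (nat -> nums M).

(** Both components are at most the pair, so decoding costs only bounded quantifiers. *)
Lemma D0_unpair f (P : nums M -> nums M -> env -> Prop) :
  Tm f -> D0 (fun r => P (r 1%nat) (r 0%nat) (fun i => r (S (S i)))) ->
  D0 (fun r => exists a b, f r = pair a b /\ P a b r).
Proof.
  intros Hf HP. apply (D0_ext _ (fun r => exists a, a < f r + 1 /\
    exists b, b < f r + 1 /\ (f r = pair a b /\ P a b r))).
  - intros r. split.
    + intros [a [b [E H]]]. exists a. split.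
      * rewrite lt_S_iff, E. apply le_pair_l.
      * exists b. split; auto. rewrite lt_S_iff, E. apply le_pair_r.
    + intros [a [_ [b [_ H]]]]. eauto.
  - assert (Hs := Tm_subst_S _ Hf). assert (Hss := Tm_subst_S _ Hs).
    apply D0_ex; [auto using Tm_add, Tm_cst|].
    apply D0_ex; [auto using Tm_add, Tm_cst|].
    apply D0_and; [|exact HP]. apply D0_eq; [exact Hss | tm].
Qed.

(** A quantifier bounded by [f r + 1] names the value of the term, in place of a substitution inside
    the formula. *)
Lemma D0_comp1 (R : nums M -> Prop) f :
  D0 (fun r => R (r 0%nat)) -> Tm f -> D0 (fun r : env => R (f r)).
Proof.
  intros HR Hf.
  apply (D0_ext _ (fun r => exists a, a < f r + 1 /\ (a = f r /\ R a))).
  - intros r. split; [|intros [a [_ [-> H]]]; exact H].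
    intros H. exists (f r). auto using lt_succ_diag.
  - assert (Hs := Tm_subst_S _ Hf).
    apply D0_ex; [tm; exact Hf|]. apply D0_and; [apply D0_eq; [tm | exact Hs]|].
    apply (D0_subst _ (fun r => r) (fun i => i)); auto.
Qed.

Lemma D0_comp2 (R : nums M -> nums M -> Prop) f g :
  D0 (fun r => R (r 0%nat) (r 1%nat)) -> Tm f -> Tm g ->
  D0 (fun r : env => R (f r) (g r)).
Proof.
  intros HR Hf Hg.
  apply (D0_ext _ (fun r => exists a, a < g r + 1 /\ (a = g r /\ R (f r) a))).
  - intros r. split; [|intros [a [_ [-> H]]]; exact H].
    intros H. exists (g r). auto using lt_succ_diag.
  - assert (Hs := Tm_subst_S _ Hf). assert (Hgs := Tm_subst_S _ Hg).
    apply D0_ex; [tm; exact Hg|]. apply D0_and; [apply D0_eq; [tm | exact Hgs]|].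
    apply (D0_ext _ (fun r => exists b, b < f (fun i => r (S i)) + 1 /\
      (b = f (fun i => r (S i)) /\ R b (r 0%nat)))).
    + intros r. split; [|intros [b [_ [-> H]]]; exact H].
      intros H. eexists. split; [apply lt_succ_diag | split; [reflexivity | exact H]].
    + assert (Hss := Tm_subst_S _ Hs).
      apply D0_ex; [tm; exact Hs|]. apply D0_and; [apply D0_eq; [tm | exact Hss]|].
      apply (D0_subst _ (fun r => r) (fun i => i)); auto.
Qed.

(** The two witnesses are merged into their sum, below whose successor both are found again by
    bounded quantifiers. *)
Lemma S1_and P Q : S1 P -> S1 Q -> S1 (fun r : env => P r /\ Q r).
Proof.
  intros [P' [HP EP]] [Q' [HQ EQ]].
  exists (fun k r => exists m, m < k + 1 /\ exists n, n < k + 1 /\ (P' m r /\ Q' n r)).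
  split.
  - apply D0_ex; [tm|]. apply D0_ex; [tm|]. apply D0_and.
    + apply (D0_subst (fun r => P' (r 0%nat) (fun i => r (S i)))
        (fun r => scons (r 1%nat) (fun i => r (S (S (S i)))))
        (fun i => match i with O => 1%nat | S j => S (S (S j)) end)); [|exact HP].
      intros r [|i]; reflexivity.
    + apply (D0_subst (fun r => Q' (r 0%nat) (fun i => r (S i)))
        (fun r => scons (r 0%nat) (fun i => r (S (S (S i)))))
        (fun i => match i with O => 0%nat | S j => S (S (S j)) end)); [|exact HQ].
      intros r [|i]; reflexivity.
  - intros r. rewrite EP, EQ. split.
    + intros [[m Hm] [n Hn]]. exists (m + n), m. split.
      * apply lt_S_iff, le_add_r.
      * exists n. split; auto. apply lt_S_iff, le_add_l.
    + intros [k [m [_ [n [_ [Hm Hn]]]]]]. eauto.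
Qed.

Lemma S1_ex (P : nums M -> env -> Prop) :
  S1 (fun r => P (r O) (fun i => r (S i))) -> S1 (fun r => exists a, P a r).
Proof.
  intros [P' [HP EP]].
  exists (fun k r => exists m, m < k + 1 /\ exists a, a < k + 1 /\ P' m (scons a r)).
  split.
  - apply D0_ex; [tm|]. apply D0_ex; [tm|].
    apply (D0_subst (fun r => P' (r 0%nat) (fun i => r (S i)))
        (fun r => scons (r 1%nat) (scons (r 0%nat) (fun i => r (S (S (S i))))))
        (fun i => match i with O => 1%nat | S O => O | S (S j) => S (S (S j)) end));
      [|exact HP].
    intros r [|[|i]]; reflexivity.
  - intros r. split.
    + intros [a Ha]. apply (EP (scons a r)) in Ha. destruct Ha as [m Hm].
      exists (m + a), m. split.
      * apply lt_S_iff, le_add_r.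
      * exists a. split; auto. apply lt_S_iff, le_add_l.
    + intros [k [m [_ [a [_ H]]]]]. exists a. apply (EP (scons a r)). eauto.
Qed.

Lemma S1_or P Q : S1 P -> S1 Q -> S1 (fun r : env => P r \/ Q r).
Proof.
  intros HP HQ.
  (* The number [a] selects the disjunct, which turns the disjunction of two existential statements
     into a single one. *)
  apply (S1_ext _ (fun r => exists a : nums M, (a = 0 /\ P r) \/ (a <> 0 /\ Q r))).
  - intros r. split.
    + intros [H|H]; [exists 0 | exists (0 + 1)]; [tauto|].
      right. split; auto. apply (@succ_neq_zero M model_basic).
    + intros [a [[_ H]|[_ H]]]; auto.
  - destruct HP as [P' [HP EP]], HQ as [Q' [HQ EQ]].
    apply (S1_ext _ (fun r => exists (a : nums M) m, (a = 0 /\ P' m r) \/ (a <> 0 /\ Q' m r))).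
    + intros r. split; intros [a H]; exists a.
      * rewrite EP, EQ in H. destruct H as [[H [m K]]|[H [m K]]]; eauto.
      * rewrite EP, EQ. destruct H as [m [[H K]|[H K]]]; eauto.
    + apply S1_ex, S1_ex, S1_D0, D0_or; apply D0_and; try d0.
      * apply (D0_subst (fun r => P' (r 0%nat) (fun i => r (S i)))
          (fun r => scons (r 0%nat) (fun i => r (S (S i))))
          (fun i => match i with O => O | S j => S (S j) end)); [|exact HP].
        intros r [|i]; reflexivity.
      * apply (D0_subst (fun r => Q' (r 0%nat) (fun i => r (S i)))
          (fun r => scons (r 0%nat) (fun i => r (S (S i))))
          (fun i => match i with O => O | S j => S (S j) end)); [|exact HQ].
        intros r [|i]; reflexivity.
Qed.

(** Pi^0_1 induction follows from Sigma^0_1 induction by running downwards: a failure at [a] yields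
    a failure at [a - i] for each [i <= a], and finally at 0. *)
Lemma S1_not_induction (P : nums M -> Prop) : S1 (fun r => ~ P (r O)) ->
  P 0 -> (forall n, P n -> P (n + 1)) -> forall n, P n.
Proof.
  intros HP H0 HS a. apply NNPP. intros Ha.
  enough (K : forall i, exists b, i <= a -> b + i = a /\ ~ P b).
  { destruct (K a) as [b Hb]. destruct Hb as [E Hb]; [auto|].
    assert (b = 0) by (apply (add_cancel_r _ _ a); rewrite E; ring).
    subst b. auto. }
  s1_induction.
  - apply (S1_ext _ (fun r => a < r 0%nat \/ exists b, b + r 0%nat = a /\ ~ P b)).
    + intros r. split.
      * intros [b Hb]. destruct (classic (r 0%nat <= a)) as [K|K]; [eauto|].
        left. apply not_le_lt, K.
      * intros [K|[b Hb]]; [|eauto]. exists 0. rewrite le_not_lt. tauto.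
    + apply S1_or; [apply S1_D0; d0|]. apply S1_ex, S1_and; [apply S1_D0; d0|].
      destruct HP as [Q [HQ EQ]].
      exists (fun m r => Q m (scons (r O) (fun i => r (S (S i))))). split.
      * apply (D0_subst (fun r => Q (r 0%nat) (fun i => r (S i)))
          (fun r => scons (r 0%nat) (scons (r 1%nat) (fun i => r (S (S (S i))))))
          (fun i => match i with O => O | S O => 1%nat | S (S j) => S (S (S j)) end));
          [|exact HQ].
        intros r [|[|i]]; reflexivity.
      * intros r. apply (EQ (scons (r O) (fun i => r (S (S i))))).
  - exists a. intros _. split; [ring|auto].
  - intros i [b Hb].
    destruct (classic (i + 1 <= a)) as [K|K]; [|exists 0; tauto].
    assert (L : i <= a) by (left; apply lt_le_succ, K).
    destruct (Hb L) as [E Nb]. destruct (zero_or_succ b) as [->|[c ->]]; [tauto|].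
    exists c. intros _. split.
    + rewrite <- E. ring.
    + intros Hc. apply Nb, HS, Hc.
Qed.

Lemma least (P : nums M -> Prop) : D0 (fun r => P (r O)) ->
  forall n, P n -> exists m, m <= n /\ P m /\ forall k, k < m -> ~ P k.
Proof.
  intros HP n Hn. apply NNPP. intros H.
  assert (K : forall m, m <= n + 1 -> forall k, k < m -> ~ P k).
  { apply (D0_induction (fun m => m <= n + 1 -> forall k, k < m -> ~ P k)).
    - apply D0_imp; [d0|]. apply D0_all; [tm|]. apply D0_not.
      apply (D0_subst (fun r => P (r 0%nat)) (fun r => r) (fun i => i)); auto.
    - intros _ k Hk. destruct (lt_irrefl_0 _ Hk).
    - intros m IH Hm k Hk Pk. apply lt_S_iff in Hk.
      assert (Hm' : m <= n) by (apply lt_S_iff, lt_le_succ, Hm).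
      assert (Hm1 : m <= n + 1) by (left; apply lt_S_iff, Hm').
      destruct Hk as [Hk| ->]; [exact (IH Hm1 k Hk Pk)|].
      apply H. exists m. eauto. }
  apply (K (n + 1) (or_intror eq_refl) n (lt_succ_diag n) Hn).
Qed.

End Arithmetic.

Ltac d0 ::= repeat (cbv beta; first
  [ apply D0_cst | solve [auto 1 with d0]
  | apply D0_eq; solve [tm] | apply D0_lt; solve [tm]
  | apply D0_mem; solve [tm] | apply D0_and | apply D0_or | apply D0_not
  | (apply D0_ex; [solve [tm]|]) | (apply D0_all; [solve [tm]|])
  | (apply D0_unpair; [solve [tm]|])
  | apply D0_imp ]).

(** * Codes of finite sets *)

Definition divides {M : L2structure} (a b : nums M) : Prop := exists q, b = a * q.

Section Codes.
Context {M : L2structure} {HM : model M}.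
Implicit Types x y z : nums M.
Notation env := (nat -> nums M).

Add Ring nums_ring_codes : (nums_semiring (M := M)).

Lemma succ_neq_0 x : x + 1 <> 0.
Proof. apply (succ_neq_zero (RCA0_basic model_RCA0)). Qed.

Lemma le_mul_pos x y : y <> 0 -> x <= x * y.
Proof.
  destruct (zero_or_succ y) as [->|[z ->]]; [tauto|].
  intros _. apply le_iff_add. exists (x * z). ring.
Qed.

(** For nonzero [a] a quotient is at most [b]; for [a = 0] it is arbitrary, so 0 is chosen. *)
Lemma divides_bounded (a b : nums M) :
  divides a b <-> exists q, q < b + 1 /\ b = a * q.
Proof.
  split; [|intros [q [_ E]]; exists q; exact E].
  intros [q E]. destruct (classic (a = 0)) as [->|Ha].
  - exists 0. split; [apply lt_S_iff, le_0_l | rewrite E; ring].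
  - exists q. split; [|exact E]. apply lt_S_iff. rewrite E, mul_comm.
    apply le_mul_pos, Ha.
Qed.

Lemma D0_divides f g : Tm f -> Tm g -> D0 (fun r : env => divides (f r) (g r)).
Proof.
  apply D0_comp2. eapply D0_ext; [intros r; apply divides_bounded|]. d0.
Qed.

Lemma divides_0_r x : divides x 0.
Proof. exists 0. ring. Qed.

Lemma divides_refl x : divides x x.
Proof. exists 1. ring. Qed.

Lemma divides_mul_r x y z : divides x y -> divides x (y * z).
Proof. intros [q ->]. exists (q * z). ring. Qed.

Lemma divides_mul_l x y z : divides x y -> divides x (z * y).
Proof. rewrite (mul_comm z). apply divides_mul_r. Qed.

Lemma divides_add_cancel x b z : divides x b -> divides x (b + z) -> divides x z.
Proof.
  intros [y ->] [q E]. destruct (lt_total y q) as [H|[->|H]].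
  - apply lt_iff_add in H. destruct H as [w ->]. exists (w + 1).
    apply (add_cancel_l _ _ (x * y)). rewrite E. ring.
  - exists 0. apply (add_cancel_l _ _ (x * q)). rewrite E. ring.
  - apply lt_iff_add in H. destruct H as [w ->].
    assert (K : x * (w + 1) + z = 0).
    { apply (add_cancel_l _ _ (x * q)). rewrite add_0_r.
      transitivity (x * (q + w + 1) + z); [ring | exact E]. }
    destruct (zero_or_succ z) as [->|[v ->]]; [apply divides_0_r|].
    destruct (succ_neq_0 (x * (w + 1) + v)). rewrite <- K. ring.
Qed.

#[local] Hint Extern 2 (D0 _) => apply D0_divides; solve [tm] : d0.

Section Moduli.
Variables k p : nums M.
Hypothesis p_pos : p <> 0.
Hypothesis p_div : forall i, i < k -> divides (i + 1) p.
Notation u i := (p * (i + 1) + 1).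

Lemma modulus_not_divides_1 i : ~ divides (u i) 1.
Proof.
  destruct (zero_or_succ p) as [E|[v E]]; [tauto|].
  intros [q H]. destruct (zero_or_succ q) as [->|[w ->]].
  - rewrite mul_0_r in H. apply (succ_neq_0 0). rewrite add_0_l. exact H.
  - apply (succ_neq_0 ((v + 1) * (i + 1) * w + w + v * i + i + v)).
    apply (add_cancel_r _ _ 1). rewrite add_0_l. symmetry.
    transitivity (u i * (w + 1)); [exact H | rewrite E; ring].
Qed.

(* As [p * (i + 1)] is [-1] modulo [u i], [p] and its divisors are invertible. *)
Lemma modulus_coprime_divisor i a x :
  divides a p -> divides (u i) (a * x) -> divides (u i) x.
Proof.
  intros [q E] H. apply (divides_mul_r _ _ (q * (i + 1))) in H.
  apply (divides_add_cancel _ _ x H).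
  replace (a * x * (q * (i + 1)) + x) with ((a * q * (i + 1) + 1) * x) by ring.
  rewrite <- E. apply divides_mul_r, divides_refl.
Qed.

(** Coprimality is expressed as cancellation, which avoids greatest common divisors. The difference
    of two moduli is [p * (w + 1)] with [w < k]; both factors divide [p], hence are invertible
    modulo [u i]. *)
Lemma moduli_coprime i j x : i < k -> j < k -> i <> j ->
  divides (u i) (u j * x) -> divides (u i) x.
Proof.
  intros Hi Hj Hij H.
  enough (exists w, w < k /\ divides (u i) (p * ((w + 1) * x))) as [w [Hw K]].
  { apply modulus_coprime_divisor in K; [|apply divides_refl].
    apply modulus_coprime_divisor in K; auto. }
  destruct (lt_total i j) as [L|[L|L]]; [|tauto|];
    apply lt_iff_add in L; destruct L as [w ->]; exists w.
  - split.
    + eapply le_lt_trans; [|exact Hj]. apply le_iff_add. exists (i + 1). ring.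
    + apply (divides_add_cancel _ (u i * x)); [apply divides_mul_r, divides_refl|].
      replace (u i * x + p * ((w + 1) * x)) with (u (i + w + 1) * x) by ring.
      exact H.
  - split.
    + eapply le_lt_trans; [|exact Hi]. apply le_iff_add. exists (j + 1). ring.
    + apply (divides_add_cancel _ _ _ H).
      replace (u j * x + p * ((w + 1) * x)) with (u (j + w + 1) * x) by ring.
      apply divides_mul_r, divides_refl.
Qed.

(* For [i] not yet selected the invariant keeps [u i] coprime to [n], tested on
   [q <= N] only so that it is a bounded formula. *)
Lemma select_moduli N (X : sets M) : N <> 0 ->
  (forall i, i < k -> divides (u i) N) ->
  exists n, n <= N /\ forall i, i < k -> (divides (u i) n <-> i ∈ X).
Proof.
  intros HN Hdiv.
  enough (K : forall j, exists n, n < N + 1 /\ divides n N /\ forall i, i < k ->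
    (i < j /\ i ∈ X -> divides (u i) n) /\
    (~ (i < j /\ i ∈ X) -> forall q, q < N + 1 ->
       divides (u i) (n * q) -> divides (u i) q)).
  { destruct (K k) as [n [Hn [_ Hi]]]. exists n. split; [apply lt_S_iff, Hn|].
    intros i Hik. destruct (Hi i Hik) as [H1 H2]. split; [|tauto].
    (* If an unselected modulus divided [n], that is [n * 1], cancelling [n] with [q = 1] would make
       it divide 1. *)
    intros D. apply NNPP. intros C. apply (modulus_not_divides_1 i).
    apply H2; [tauto| |rewrite mul_1_r; exact D].
    destruct (zero_or_succ N) as [->|[v ->]]; [tauto|].
    apply lt_S_iff, le_add_l. }
  d0_induction.
  - d0.
  - exists 1. split; [|split].
    + destruct (zero_or_succ N) as [->|[v ->]]; [tauto|]. apply lt_S_iff, le_add_l.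
    + exists N. ring.
    + intros i Hi. split; [intros [H _]; destruct (lt_irrefl_0 _ H)|].
      intros _ q _. replace (1 * q) with q by ring. auto.
  - intros j [n [Hn [[r Er] Hi]]].
    destruct (classic (j < k /\ j ∈ X)) as [[Hj HX]|Hj].
    (* [r] is the cofactor of [n] in [N]. The modulus [u j] divides [n * r] and is coprime to [n],
       so it divides [r], and [n * u j] still divides [N]. *)
    + assert (Dr : divides (u j) r).
      { apply (proj2 (Hi j Hj)).
        - intros [H _]. apply (lt_irrefl _ H).
        - apply lt_S_iff. rewrite Er, mul_comm. apply le_mul_pos.
          intros ->. apply HN. rewrite Er. ring.
        - rewrite <- Er. auto. }
      destruct Dr as [t ->].
      exists (n * u j). split; [|split].
      * apply lt_S_iff. rewrite Er, mul_assoc. apply le_mul_pos.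
        intros ->. apply HN. rewrite Er. ring.
      * exists t. rewrite Er. ring.
      * intros i Hik. destruct (Hi i Hik) as [H1 H2].
        destruct (classic (i = j)) as [->|Hne].
        -- split; [intros _; apply divides_mul_l, divides_refl|].
           intros C. destruct C. split; [apply lt_succ_diag | exact HX].
        -- assert (E : i < j + 1 /\ i ∈ X <-> i < j /\ i ∈ X)
             by (rewrite lt_S_iff; tauto).
           rewrite E. split; [intros C; apply divides_mul_r; auto|].
           intros C q Hq D. apply H2; auto.
           apply (moduli_coprime i j); auto.
           replace (u j * (n * q)) with (n * u j * q) by ring. exact D.
    + exists n. split; [exact Hn|]. split; [exists r; exact Er|].
      intros i Hik. rewrite lt_S_iff.
      assert (E : (i < j \/ i = j) /\ i ∈ X <-> i < j /\ i ∈ X).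
      { split; [|tauto]. intros [[H| ->] HX]; tauto. }
      rewrite E. auto.
Qed.

End Moduli.

(** [p] makes the moduli for indices below [k] pairwise coprime and [N] is a common multiple of
    them. Together they bound the codes of all subsets of the first [k] numbers at once. *)
Definition moduli_base (k p N : nums M) : Prop :=
  p <> 0 /\ N <> 0 /\ (forall i, i < k -> divides (i + 1) p) /\
  (forall i, i < k -> divides (p * (i + 1) + 1) N).

(** Factorials and iterated products are not terms, so the multiple is built by Sigma^0_1 induction,
    one factor per step. *)
Lemma common_multiple (f : nums M -> nums M) k :
  Tm (fun r : env => f (r 0%nat)) -> (forall i, f i <> 0) ->
  exists N, N <> 0 /\ forall i, i < k -> divides (f i) N.
Proof.
  intros Hf Hpos. revert k. s1_induction.
  - apply S1_ex_D0. apply D0_and; [d0|]. apply D0_all; [tm|].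
    apply (D0_comp2 (fun i N => divides (f i) N)); [|tm|tm].
    apply D0_divides; [exact Hf | tm].
  - exists 1. split.
    + rewrite <- (add_0_l 1). apply succ_neq_0.
    + intros i Hi. destruct (lt_irrefl_0 _ Hi).
  - intros k [N [HN H]]. exists (N * f k). split.
    + intros E. apply mul_eq_0 in E. destruct E; [tauto|]. apply (Hpos k); auto.
    + intros i Hi. apply lt_S_iff in Hi. destruct Hi as [Hi| ->].
      * apply divides_mul_r; auto.
      * apply divides_mul_l, divides_refl.
Qed.

Lemma moduli_base_exists k : exists p N, moduli_base k p N.
Proof.
  destruct (common_multiple (fun i => i + 1) k) as [p [Hp Dp]];
    [tm | intros i; apply succ_neq_0 |].
  destruct (common_multiple (fun i => p * (i + 1) + 1) k) as [N [HN DN]];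
    [tm | intros i; apply succ_neq_0 |].
  exists p, N. repeat split; auto.
Qed.

Lemma D0_code_mem f g : Tm f -> Tm g -> D0 (fun r : env => code_mem (f r) (g r)).
Proof.
  apply D0_comp2.
  apply (D0_ext _ (fun r => exists k a, r 1%nat = pair k a /\ (r 0%nat < k /\
    exists m n, a = pair m n /\ divides (m * (r 0%nat + 1) + 1) n))).
  - intros r. split.
    + intros [k [m [n [E [Hi D]]]]]. exists k, (pair m n). split; auto.
      split; auto. exists m, n. auto.
    + intros [k [a [E [Hi [m [n [-> D]]]]]]]. exists k, m, n. auto.
  - d0.
Qed.
#[local] Hint Extern 2 (D0 _) => apply D0_code_mem; solve [tm] : d0.

Lemma code_mem_lt (i c : nums M) : code_mem i c -> i < c.
Proof.
  intros [k [m [n [-> [H _]]]]]. eapply lt_le_trans; [exact H | apply le_pair_l].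
Qed.

Lemma same_members_bounded (c c' : nums M) :
  (forall i, code_mem i c <-> code_mem i c') <->
  (forall i, i < c + c' -> (code_mem i c <-> code_mem i c')).
Proof.
  split; [auto|]. intros H i. split; intros K; apply H; auto;
    (eapply lt_le_trans; [apply (code_mem_lt _ _ K)|]); [apply le_add_r | apply le_add_l].
Qed.

Lemma finset_code_unique (c c' : nums M) : finset_code c -> finset_code c' ->
  (forall i, code_mem i c <-> code_mem i c') -> c = c'.
Proof.
  intros Hc Hc' H. destruct (lt_total c c') as [K|[K|K]]; auto; exfalso.
  - apply (Hc' c K), H.
  - apply (Hc c' K). intros i. symmetry. apply H.
Qed.

(** [select_moduli] gives a number [c0] with the right members. The code is the least number with
    these members and inherits the bound, which does not depend on [X]. *)
Lemma finset_code_exists k p N (X : sets M) : moduli_base k p N ->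
  exists c, c <= pair k (pair p N) /\ finset_code c /\
    forall i, code_mem i c <-> i < k /\ i ∈ X.
Proof.
  intros [Hp [HN [Dp DN]]].
  destruct (select_moduli k p Hp Dp N X HN DN) as [n [Hn Hsel]].
  set (c0 := pair k (pair p n)).
  assert (Hc0 : forall i, code_mem i c0 <-> i < k /\ i ∈ X).
  { intros i. split.
    - intros [k' [p' [n' [E [Hi D]]]]]. apply pair_inj in E. destruct E as [<- E].
      apply pair_inj in E. destruct E as [<- <-]. split; [exact Hi|].
      apply Hsel; auto.
    - intros [Hi HX]. exists k, p, n. repeat split; auto. apply Hsel; auto. }
  destruct (least (fun c => forall i, i < c + c0 -> (code_mem i c <-> code_mem i c0)))
    with (n := c0) as [c [Hc [Hs Hmin]]].
  - unfold iff. d0.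
  - tauto.
  - exists c. split; [|split].
    + eapply le_trans; [exact Hc|]. apply pair_mono; [auto|].
      apply pair_mono; auto.
    + intros c' Hc' E. apply (Hmin c' Hc'), same_members_bounded.
      intros i. rewrite E. apply same_members_bounded, Hs.
    + intros i. rewrite <- Hc0. apply same_members_bounded, Hs.
Qed.

Lemma finset_code_bounded k p N c : moduli_base k p N -> finset_code c ->
  (forall i, code_mem i c -> i < k) -> c <= pair k (pair p N).
Proof.
  intros Hb Hc Hk.
  destruct (D0_comprehension (fun i => code_mem i c)) as [X HX]; [d0|].
  destruct (finset_code_exists k p N X Hb) as [c' [Hle [Hc' H]]].
  replace c with c'; [exact Hle|]. apply finset_code_unique; auto.
  intros i. rewrite H, HX. split; [tauto|]. auto.
Qed.

Lemma finset_code_of (P : nums M -> Prop) k : D0 (fun r : env => P (r 0%nat)) ->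
  exists c, finset_code c /\ forall i, code_mem i c <-> i < k /\ P i.
Proof.
  intros HP. destruct (D0_comprehension P HP) as [X HX].
  destruct (moduli_base_exists k) as [p [N Hb]].
  destruct (finset_code_exists k p N X Hb) as [c [_ [Hc H]]].
  exists c. split; [exact Hc|]. intros i. rewrite H, HX. tauto.
Qed.

(** * Finite binary sequences *)

Lemma D0_entry f g h : Tm f -> Tm g -> Tm h ->
  D0 (fun r : env => entry (f r) (g r) (h r)).
Proof. intros. apply D0_code_mem; tm; assumption. Qed.
#[local] Hint Extern 2 (D0 _) => apply D0_entry; solve [tm] : d0.

Lemma entry_lt (s i j : nums M) : entry s i j -> i < s /\ j < s.
Proof.
  intros H. apply code_mem_lt in H.
  split; (eapply le_lt_trans; [|exact H]); [apply le_pair_l | apply le_pair_r].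
Qed.

Lemma D0_has_length f g : Tm f -> Tm g -> D0 (fun r : env => has_length (f r) (g r)).
Proof.
  apply D0_comp2.
  apply (D0_ext _ (fun r => forall i, i < r 0%nat + r 1%nat ->
    (i < r 1%nat <-> exists j, j < r 0%nat /\ entry (r 0%nat) i j))).
  - intros r. split.
    + intros H i _. rewrite (H i). split; intros [j Hj]; exists j; [|tauto].
      split; auto. apply (entry_lt _ _ _ Hj).
    + intros H i. split.
      * intros Hi. apply H in Hi; [destruct Hi as [j [_ Hj]]; eauto|].
        eapply lt_le_trans; [exact Hi | apply le_add_l].
      * intros [j Hj]. destruct (entry_lt _ _ _ Hj). apply H; [|eauto].
        eapply lt_le_trans; [eassumption | apply le_add_r].
  - unfold iff. d0.
Qed.
#[local] Hint Extern 2 (D0 _) => apply D0_has_length; solve [tm] : d0.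

Lemma D0_initial_segment f g :
  Tm f -> Tm g -> D0 (fun r : env => initial_segment (f r) (g r)).
Proof.
  apply D0_comp2.
  apply (D0_ext _ (fun r => forall i, i < r 0%nat -> forall j, j < r 0%nat ->
    entry (r 0%nat) i j -> entry (r 1%nat) i j)).
  - intros r. split; [intros H i _ j _; apply H|].
    intros H i j K. destruct (entry_lt _ _ _ K). apply H; auto.
  - d0.
Qed.
#[local] Hint Extern 2 (D0 _) => apply D0_initial_segment; solve [tm] : d0.

Lemma D0_moduli_base (f g h : env -> nums M) : Tm f -> Tm g -> Tm h ->
  D0 (fun r : env => moduli_base (f r) (g r) (h r)).
Proof.
  intros Hf Hg Hh. assert (Hg' := Tm_subst_S _ Hg). assert (Hh' := Tm_subst_S _ Hh).
  unfold moduli_base. repeat apply D0_and.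
  - apply D0_not, D0_eq; [exact Hg | tm].
  - apply D0_not, D0_eq; [exact Hh | tm].
  - apply D0_all; [exact Hf|]. apply D0_divides; [tm | exact Hg'].
  - apply D0_all; [exact Hf|]. apply D0_divides; [|exact Hh']. tm. exact Hg'.
Qed.

Lemma has_length_unique (s l l' : nums M) : has_length s l -> has_length s l' -> l = l'.
Proof.
  assert (K : forall l l', has_length s l -> has_length s l' -> ~ l < l').
  { clear l l'. intros l l' H H' K. apply H', H in K. exact (lt_irrefl _ K). }
  intros H H'. destruct (lt_total l l') as [L|[L|L]]; [|exact L|]; exfalso.
  - exact (K l l' H H' L).
  - exact (K l' l H' H L).
Qed.

Lemma pair_lt_bit (i j m : nums M) : i < m -> j = 0 \/ j = 1 -> pair i j < pair m 1.
Proof.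
  intros Hi Hj. apply pair_lt_aux.
  apply lt_le_trans with (m + j).
  - apply lt_iff_add in Hi. destruct Hi as [w ->]. apply lt_iff_add. exists w. ring.
  - apply add_le_mono; [auto|]. destruct Hj as [-> | ->]; [|auto].
    apply le_0_l.
Qed.

(** The entries of a binary sequence of length at most [k] are pairs below [pair k 1], so the
    sequence codes a subset of these numbers. *)
Lemma binary_seq_bounded k p N (s l : nums M) :
  moduli_base (pair k 1) p N -> binary_seq s -> has_length s l -> l <= k ->
  s <= pair (pair k 1) (pair p N).
Proof.
  intros Hb [[Hf [Hp _]] Hbin] Hl Hlk. apply finset_code_bounded; auto.
  intros z Hz. destruct (Hp z Hz) as [i [j ->]].
  apply pair_lt_bit; [|exact (Hbin _ _ Hz)].
  apply lt_le_trans with l; [|exact Hlk]. apply Hl. exists j. exact Hz.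
Qed.

Lemma seq_code_of (P : nums M -> nums M -> Prop) k l :
  D0 (fun r : env => P (r 1%nat) (r 0%nat)) ->
  (forall i j, P i j -> pair i j < k) ->
  (forall i j j', P i j -> P i j' -> j = j') ->
  (forall i, i < l <-> exists j, P i j) ->
  exists s, seq_code s /\ has_length s l /\ forall i j, entry s i j <-> P i j.
Proof.
  intros HP Hk Hfun Hl.
  destruct (finset_code_of (fun z => exists i j, z = pair i j /\ P i j) k) as [s [Hs H]].
  { apply D0_unpair; [tm|].
    apply (D0_subst _ (fun r => r) (fun i => i)); auto. }
  assert (E : forall i j, entry s i j <-> P i j).
  { intros i j. unfold entry. rewrite H. split.
    - intros [_ [i' [j' [E HP']]]]. apply pair_inj in E. destruct E as [-> ->]. exact HP'.
    - intros HP'. split; auto. exists i, j. auto. }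
  assert (L : has_length s l).
  { intros i. rewrite Hl. split; intros [j Hj]; exists j; apply E; auto. }
  exists s. split; [|split]; auto.
  split; [exact Hs|]. split; [|split].
  - intros z Hz. apply H in Hz. destruct Hz as [_ [i [j [-> _]]]]. eauto.
  - intros i j j' Hj Hj'. apply E in Hj, Hj'. eauto.
  - exists l. exact L.
Qed.

Lemma seq_restrict (s l m : nums M) : seq_code s -> has_length s l -> m <= l ->
  exists t, seq_code t /\ has_length t m /\
    forall i j, entry t i j <-> i < m /\ entry s i j.
Proof.
  intros [_ [_ [Hfun _]]] Hl Hm. apply (seq_code_of _ s).
  - d0.
  - intros i j [_ H]. apply code_mem_lt, H.
  - intros i j j' [_ H] [_ H']. eauto.
  - intros i. split.
    + intros Hi. assert (K : i < l) by (eapply lt_le_trans; eauto).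
      apply Hl in K. destruct K as [j Hj]. eauto.
    + intros [j [Hi _]]. exact Hi.
Qed.

Lemma seq_extend (s l b : nums M) : seq_code s -> has_length s l ->
  exists t, seq_code t /\ has_length t (l + 1) /\
    forall i j, entry t i j <-> entry s i j \/ (i = l /\ j = b).
Proof.
  intros [_ [_ [Hfun _]]] Hl.
  assert (Hnew : forall j, ~ entry s l j).
  { intros j Hj. apply (lt_irrefl l), Hl. eauto. }
  apply (seq_code_of _ (s + pair l b + 1)).
  - d0.
  - intros i j [H|[-> ->]]; apply lt_S_iff.
    + left. eapply lt_le_trans; [apply code_mem_lt, H | apply le_add_r].
    + apply le_add_l.
  - intros i j j' [H|[-> ->]] [H'|[E ->]]; eauto; subst; exfalso; eapply Hnew; eauto.
  - intros i. rewrite lt_S_iff, (Hl i). split.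
    + intros [[j Hj]| ->]; eauto.
    + intros [j [Hj|[-> _]]]; eauto.
Qed.

Lemma empty_seq : exists t : nums M, seq_code t /\ has_length t 0 /\
  forall i j, ~ entry t i j.
Proof.
  destruct (seq_code_of (fun _ _ => False) 0 0) as [t [Ht [Hl H]]].
  - d0.
  - intros i j [].
  - intros i j j' [].
  - intros i. split; [|intros [_ []]]. intros H. destruct (lt_irrefl_0 _ H).
  - exists t. split; [exact Ht|]. split; [exact Hl|]. intros i j K. apply H in K. exact K.
Qed.

End Codes.

#[export] Hint Extern 2 (D0 _) => apply D0_divides; solve [tm] : d0.
#[export] Hint Extern 2 (D0 _) => apply D0_code_mem; solve [tm] : d0.
#[export] Hint Extern 2 (D0 _) => apply D0_entry; solve [tm] : d0.
#[export] Hint Extern 2 (D0 _) => apply D0_has_length; solve [tm] : d0.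
#[export] Hint Extern 2 (D0 _) => apply D0_initial_segment; solve [tm] : d0.

(** * Standard finite cardinalities *)

(** The values are chosen one at a time into a list of length [S d]; with pairwise distinct entries
    it would be too long to fit into [seq 0 d]. *)
Lemma pigeonhole (R : nat -> nat -> Prop) d :
  (forall k, (k <= d)%nat -> exists j, (j < d)%nat /\ R k j) ->
  exists k k' j, (k < k' <= d)%nat /\ R k j /\ R k' j.
Proof.
  intros H.
  assert (L : forall n, (n <= S d)%nat -> exists l, length l = n /\
    incl l (seq 0 d) /\ forall k, (k < n)%nat -> R k (nth k l 0%nat)).
  { induction n as [|n IH]; intros Hn.
    - exists []. split; [reflexivity|]. split; [intros x []|]. intros k Hk. lia.
    - destruct IH as [l [Hl [Hi HR]]]; [lia|].
      destruct (H n) as [j [Hj Rj]]; [lia|].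
      exists (l ++ [j]). split; [rewrite length_app, Hl; simpl; lia|]. split.
      + apply incl_app; [exact Hi|]. intros x [<-|[]]. apply in_seq. lia.
      + intros k Hk. destruct (Nat.eq_dec k n) as [->|Hne].
        * rewrite app_nth2, Hl, Nat.sub_diag; [exact Rj | lia].
        * rewrite app_nth1 by lia. apply HR. lia. }
  destruct (L (S d)) as [l [Hl [Hi HR]]]; [lia|].
  apply NNPP. intros C.
  assert (ND : NoDup l).
  { apply (NoDup_nth l 0%nat). intros i j Hli Hlj E.
    destruct (Nat.lt_total i j) as [K|[K|K]]; auto; exfalso; apply C.
    - exists i, j, (nth i l 0%nat). split; [lia|]. split; [|rewrite E]; apply HR; lia.
    - exists j, i, (nth j l 0%nat). split; [lia|]. split; [|rewrite <- E]; apply HR; lia. }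
  apply (NoDup_incl_length ND) in Hi. rewrite length_seq in Hi. lia.
Qed.

Section Finite.
Context {M : L2structure} {HM : model M}.
Notation env := (nat -> nums M).

(** Even in a nonstandard model only standard numbers lie below a standard numeral. This moves
    questions about [d] colours and [d + 1] vertices to [nat]. *)
Lemma lt_numeral d (x : nums M) :
  x < numeral M d <-> exists j, (j < d)%nat /\ x = numeral M j.
Proof.
  induction d as [|d IH]; simpl.
  - split; [intros H; destruct (lt_irrefl_0 _ H) | intros [j [Hj _]]; lia].
  - rewrite lt_S_iff, IH. split.
    + intros [[j [Hj ->]]| ->]; [exists j | exists d]; auto.
    + intros [j [Hj ->]]. destruct (Nat.eq_dec j d) as [->|Hne]; [auto|].
      left. exists j. split; auto. lia.
Qed.

Lemma numeral_lt i j : (i < j)%nat -> numeral M i < numeral M j.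
Proof. intros H. apply lt_numeral. eauto. Qed.

Lemma numeral_inj i j : numeral M i = numeral M j -> i = j.
Proof.
  intros H. destruct (Nat.lt_total i j) as [K|[K|K]]; auto;
    apply numeral_lt in K; rewrite H in K; destruct (lt_irrefl _ K).
Qed.

(** A quantifier over standard numbers below [d] abbreviates a disjunction of [d] formulas, which
    may differ from one another. *)
Lemma D0_ex_nat d (P : nat -> env -> Prop) : (forall i, D0 (P i)) ->
  D0 (fun r => exists i, (i < d)%nat /\ P i r).
Proof.
  intros H. induction d as [|d IH].
  - apply (D0_ext _ (fun _ => False)); [|d0]. intros r.
    split; [intros [i [Hi _]]; lia | tauto].
  - apply (D0_ext _ (fun r => (exists i, (i < d)%nat /\ P i r) \/ P d r)).
    + intros r. split.
      * intros [i [Hi K]]. destruct (Nat.eq_dec i d) as [->|Hne]; [auto|].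
        left. exists i. split; auto. lia.
      * intros [[i [Hi K]]|K]; [exists i | exists d]; auto.
    + apply D0_or; auto.
Qed.

#[local] Hint Extern 2 (D0 _) => apply D0_ex_nat; intros; solve [d0] : d0.

Lemma has_card_list (P : nums M -> Prop) l : NoDup l -> (forall y, P y <-> In y l) ->
  has_card P (numeral M (length l)).
Proof.
  intros ND HP.
  destruct (D0_comprehension (fun z => exists i, (i < length l)%nat /\
    z = pair (numeral M i) (nth i l 0))) as [F HF].
  { apply D0_ex_nat. intros i. d0. }
  assert (HF' : forall x y, maps F x y <->
    exists i, (i < length l)%nat /\ x = numeral M i /\ y = nth i l 0).
  { intros x y. unfold maps. rewrite HF. split; intros [i [Hi E]]; exists i.
    - apply pair_inj in E. tauto.
    - destruct E as [-> ->]. auto. }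
  exists F. split; [split|split].
  - intros z Hz. apply HF in Hz. destruct Hz as [i [Hi ->]].
    exists (numeral M i), (nth i l 0). split; [reflexivity|]. split.
    + apply numeral_lt, Hi.
    + apply HP, nth_In, Hi.
  - intros x Hx. apply lt_numeral in Hx. destruct Hx as [i [Hi ->]].
    exists (nth i l 0). split.
    + apply HF'. eauto.
    + intros y Hy. apply HF' in Hy. destruct Hy as [j [_ [E ->]]].
      apply numeral_inj in E. subst. reflexivity.
  - intros x x' y Hx Hx'. apply HF' in Hx, Hx'.
    destruct Hx as [i [Hi [-> E]]], Hx' as [j [Hj [-> E']]].
    f_equal. rewrite E in E'. apply (proj1 (NoDup_nth l 0) ND); auto.
  - intros y Hy. apply HP in Hy. destruct (In_nth _ _ 0 Hy) as [i [Hi E]].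
    exists (numeral M i). apply HF'. eauto.
Qed.

(** Membership in [P] is decided classically for each of the finitely many listed elements. The
    thinned list is an exact enumeration, which the model has as a set. *)
Lemma has_card_cover (P : nums M -> Prop) l d : (forall y, P y -> In y l) ->
  (length l <= d)%nat -> exists n, has_card P n /\ n <= numeral M d.
Proof.
  intros HP Hl.
  assert (H : exists l', NoDup l' /\ (length l' <= length l)%nat /\
    forall y, In y l' <-> P y /\ In y l).
  { clear HP Hl. induction l as [|x l [l' [ND [Hl H]]]].
    - exists []. split; [constructor|]. simpl. split; [lia | tauto].
    - destruct (classic (P x /\ ~ In x l')) as [K|K].
      + exists (x :: l'). split; [constructor; tauto|]. simpl. split; [lia|].
        intros y. rewrite H. split; [|tauto]. intros [<-|E]; tauto.
      + exists l'. split; [exact ND|]. simpl. split; [lia|].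
        intros y. rewrite H. split; [tauto|]. intros [Py [<-|E]]; [|tauto].
        rewrite H in K. tauto. }
  destruct H as [l' [ND [Hl' H]]]. exists (numeral M (length l')). split.
  - apply has_card_list; auto. intros y. rewrite H. split; [auto | tauto].
  - destruct (Nat.eq_dec (length l') d) as [<-|Hne]; [auto|].
    left. apply numeral_lt. lia.
Qed.

End Finite.

#[export] Hint Extern 2 (D0 _) => apply D0_ex_nat; intros; solve [d0] : d0.

(** * Separating disjoint enumerations with Brooks' theorem *)

Section Gadget.
Context {M : L2structure} {HM : model M}.
Notation env := (nat -> nums M).
Add Ring nums_ring_gadget : (nums_semiring (M := M)).

Variable d : nat.
Hypothesis d_ge_2 : (2 <= d)%nat.
Variables X Y : sets M.
Hypothesis X_unique : forall n m m', pair n m ∈ X -> pair n m' ∈ X -> m = m'.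
Hypothesis Y_unique : forall n m m', pair n m ∈ Y -> pair n m' ∈ Y -> m = m'.
Hypothesis X_Y_disjoint : forall n m m', pair n m ∈ X -> ~ pair n m' ∈ Y.

(** A clique vertex carries the stage [m] at which it gets its edges, so adjacency is decided by
    asking whether [pair n m] lies in [X] or [Y]. The ends use the indices [d] and [S d], while
    clique vertices have indices below [d]. *)
Definition vtx (n m : nums M) (i : nat) : nums M := pair n (pair m (numeral M i)).
Definition left_end (n : nums M) : nums M := vtx n 0 d.
Definition right_end (n : nums M) : nums M := vtx n 0 (S d).

Definition stage (n m : nums M) : Prop := pair n m ∈ X \/ pair n m ∈ Y.

(* The ends of [n] exist from the beginning and are joined to new vertices when
   [n] is enumerated: [vtx n m i] with [0 < i < d] form a clique whose vertices are
   all adjacent to the left end.  If [n] goes into [X] they are also adjacent to the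
   right end, which must then have the colour of the left end.  If [n] goes into
   [Y], then [vtx n m 0] extends the clique, hence has the colour of the left end,
   and is adjacent to the right end. *)
Inductive arc : nums M -> nums M -> Prop :=
| arc_clique n m i j : (i < d)%nat -> (j < d)%nat -> i <> j ->
    pair n m ∈ X /\ i <> 0%nat /\ j <> 0%nat \/ pair n m ∈ Y ->
    arc (vtx n m i) (vtx n m j)
| arc_left n m j : (0 < j < d)%nat -> stage n m -> arc (left_end n) (vtx n m j)
| arc_right n m j : (j < d)%nat ->
    pair n m ∈ X /\ j <> 0%nat \/ pair n m ∈ Y /\ j = 0%nat ->
    arc (right_end n) (vtx n m j).

Lemma vtx_inj n m i n' m' i' : vtx n m i = vtx n' m' i' -> n = n' /\ m = m' /\ i = i'.
Proof.
  intros H. apply pair_inj in H. destruct H as [Hn H].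
  apply pair_inj in H. destruct H as [Hm H]. apply numeral_inj in H. auto.
Qed.

(** The second vertex of an arc is always a clique vertex, so the stage [m] is decoded from it and
    no search is involved. *)
Lemma D0_arc : D0 (fun r : env => arc (r 0%nat) (r 1%nat)).
Proof.
  apply (D0_ext _ (fun r => exists n u, r 0%nat = pair n u /\
    exists n' w, r 1%nat = pair n' w /\ (n' = n /\
    exists m z, w = pair m z /\ exists j, (j < d)%nat /\ (z = numeral M j /\
      ((exists i, (i < d)%nat /\ (u = pair m (numeral M i) /\ (i <> j /\
          (pair n m ∈ X /\ i <> 0%nat /\ j <> 0%nat \/ pair n m ∈ Y)))) \/
       (u = pair 0 (numeral M d) /\ (j <> 0%nat /\ (pair n m ∈ X \/ pair n m ∈ Y))) \/
       (u = pair 0 (numeral M (S d)) /\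
         (pair n m ∈ X /\ j <> 0%nat \/ pair n m ∈ Y /\ j = 0%nat))))))).
  - intros r. split.
    + intros [n m i j Hi Hj Hij H | n m j Hj H | n m j Hj H].
      * exists n, (pair m (numeral M i)). split; [reflexivity|].
        exists n, (pair m (numeral M j)). do 2 (split; [reflexivity|]).
        exists m, (numeral M j). split; [reflexivity|].
        exists j. split; [exact Hj|]. split; [reflexivity|]. left. exists i. auto.
      * exists n, (pair 0 (numeral M d)). split; [reflexivity|].
        exists n, (pair m (numeral M j)). do 2 (split; [reflexivity|]).
        exists m, (numeral M j). split; [reflexivity|].
        exists j. split; [lia|]. split; [reflexivity|]. right. left.
        split; [reflexivity|]. split; [lia | exact H].
      * exists n, (pair 0 (numeral M (S d))). split; [reflexivity|].
        exists n, (pair m (numeral M j)). do 2 (split; [reflexivity|]).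
        exists m, (numeral M j). split; [reflexivity|].
        exists j. split; [exact Hj|]. split; [reflexivity|]. right. right.
        split; [reflexivity | exact H].
    + generalize (r 0%nat) (r 1%nat). clear r. intros x y.
      intros [n [u [-> [n' [w [-> [-> [m [z [-> [j [Hj [-> H]]]]]]]]]]]]].
      destruct H as [[i [Hi [-> [Hij H]]]]|[[-> [Hj0 H]]|[-> H]]].
      * apply arc_clique; auto.
      * apply arc_left; [lia | exact H].
      * apply arc_right; auto.
  - d0.
Qed.

Lemma gadget_exists : exists V E : sets M, (forall x, x ∈ V) /\
  (forall z, z ∈ E -> exists x y, z = pair x y) /\
  forall x y, adj E x y <-> arc x y \/ arc y x.
Proof.
  (* All numbers are vertices. Those that never get an edge stay isolated, so the vertex set
     requires no knowledge of the enumerations. *)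
  destruct (D0_comprehension (fun _ : nums M => True)) as [V HV]; [d0|].
  destruct (D0_comprehension (fun z : nums M =>
    exists x y, z = pair x y /\ (arc x y \/ arc y x))) as [E HE].
  { d0; apply (D0_comp2 arc); solve [apply D0_arc | tm]. }
  exists V, E. split; [intros x; apply HV; exact I|]. split.
  { intros z Hz. apply HE in Hz. destruct Hz as [x [y [-> _]]]. eauto. }
  intros x y. unfold adj. rewrite HE. split; [|eauto].
  intros [x' [y' [Exy H]]]. apply pair_inj in Exy. destruct Exy as [-> ->]. exact H.
Qed.

(* A proper colouring with [d] colours, which exists outside [M] only: the colour
    of [right_end n] depends on whether [n] is ever enumerated into [X]. *)
Inductive hue : nums M -> nat -> Prop :=
| hue_clique n m i : (i < d)%nat -> hue (vtx n m i) i
| hue_left n : hue (left_end n) 0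
| hue_right_X n m : pair n m ∈ X -> hue (right_end n) 0
| hue_right_Y n m : pair n m ∈ Y -> hue (right_end n) 1.

Lemma hue_clique_inv n m i j : (i < d)%nat -> hue (vtx n m i) j -> j = i.
Proof.
  intros Hi H. remember (vtx n m i) as x eqn:Ex.
  destruct H; apply vtx_inj in Ex; lia.
Qed.

Lemma hue_left_inv n j : hue (left_end n) j -> j = 0%nat.
Proof.
  intros H. remember (left_end n) as x eqn:Ex.
  destruct H; try apply vtx_inj in Ex; lia.
Qed.

Lemma hue_right_inv n j : hue (right_end n) j ->
  (exists m, pair n m ∈ X) /\ j = 0%nat \/ (exists m, pair n m ∈ Y) /\ j = 1%nat.
Proof.
  intros H. remember (right_end n) as x eqn:Ex.
  destruct H; apply vtx_inj in Ex; try lia; destruct Ex as [-> _]; eauto.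
Qed.

(** [hue] is partial, but only isolated vertices lack a value: a right end has one if its number is
    ever enumerated, and has no edges otherwise. *)
Lemma arc_hue x y : arc x y ->
  (exists j, (j < d)%nat /\ hue x j) /\ (exists j, (j < d)%nat /\ hue y j).
Proof.
  intros [n m i j Hi Hj Hij H | n m j Hj H | n m j Hj H]; split.
  - exists i. split; [|constructor]; assumption.
  - exists j. split; [|constructor]; assumption.
  - exists 0%nat. split; [lia | constructor].
  - exists j. split; [lia | constructor; lia].
  - destruct H as [[H _]|[H _]].
    + exists 0%nat. split; [lia | econstructor; eauto].
    + exists 1%nat. split; [lia | econstructor; eauto].
  - exists j. split; [|constructor]; assumption.
Qed.

Lemma arc_hue_proper x y j : arc x y -> hue x j -> hue y j -> False.
Proof.
  intros [n m i k Hi Hk Hik H | n m k Hk H | n m k Hk H] Hx Hy;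
    apply hue_clique_inv in Hy; try lia; subst k.
  - apply hue_clique_inv in Hx; auto.
  - apply hue_left_inv in Hx. lia.
  - apply hue_right_inv in Hx.
    destruct Hx as [[[m' Hx] ->]|[[m' Hx] ->]], H as [[H H0]|[H H0]]; try tauto.
    + exact (X_Y_disjoint _ _ _ Hx H).
    + exact (X_Y_disjoint _ _ _ H Hx).
    + discriminate.
Qed.

(** * Cliques, odd cycles, colourings and degrees of the graph *)

Section Graph.
Variables V E : sets M.
Hypothesis V_all : forall x, x ∈ V.
Hypothesis E_arc : forall x y, adj E x y <-> arc x y \/ arc y x.

Lemma adj_sym x y : adj E x y -> adj E y x.
Proof. rewrite !E_arc. tauto. Qed.

Lemma adj_hue x y : adj E x y -> exists j, (j < d)%nat /\ hue x j.
Proof. rewrite E_arc. intros [H|H]; apply arc_hue in H; tauto. Qed.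

Lemma adj_hue_proper x y j : adj E x y -> hue x j -> hue y j -> False.
Proof. rewrite E_arc. intros [H|H]; eauto using arc_hue_proper. Qed.

Lemma adj_irrefl x : ~ adj E x x.
Proof.
  intros H. destruct (adj_hue _ _ H) as [j [_ Hj]]. exact (adj_hue_proper _ _ _ H Hj Hj).
Qed.

Lemma no_clique : ~ has_clique V E (numeral M (S d)).
Proof.
  intros [C [_ [HC [F [[HF Htot] [Hinj _]]]]]].
  assert (Hin : forall i x, maps F i x -> x ∈ C).
  { intros i x Hx. destruct (HF _ Hx) as [i' [x' [Ex [_ K]]]].
    apply pair_inj in Ex. destruct Ex as [_ ->]. exact K. }
  assert (Hadj : forall k k' x x', k <> k' -> maps F (numeral M k) x ->
    maps F (numeral M k') x' -> adj E x x').
  { intros k k' x x' Hk Hx Hx'. apply HC; eauto. intros ->.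
    apply Hk, numeral_inj, (Hinj _ _ x'); auto. }
  assert (Hex : forall k, (k <= d)%nat -> exists x, maps F (numeral M k) x).
  { intros k Hk. destruct (Htot (numeral M k)) as [x [Hx _]]; [|eauto].
    apply numeral_lt. lia. }
  destruct (pigeonhole (fun k j => exists x, maps F (numeral M k) x /\ hue x j) d)
    as [k [k' [j [Hk [[x [Hx Hxj]] [x' [Hx' Hxj']]]]]]].
  - intros k Hk. destruct (Hex k Hk) as [x Hx].
    (* A second clique vertex is picked to see that [x] has a neighbour and therefore a hue. *)
    assert (exists k', (k' <= d)%nat /\ k <> k') as [k' [Hk' Hne]].
    { destruct k; [exists 1%nat | exists 0%nat]; lia. }
    destruct (Hex k' Hk') as [x' Hx'].
    destruct (adj_hue x x') as [j [Hj Hxj]]; [exact (Hadj _ _ _ _ Hne Hx Hx')|]. eauto.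
  - apply (adj_hue_proper x x' j); auto. apply (Hadj k k'); auto. lia.
Qed.

Lemma arc_component x y : arc x y -> exists n u w, x = pair n u /\ y = pair n w.
Proof.
  intros [n m i j _ _ _ _ | n m j _ _ | n m j _ _]; unfold left_end, right_end, vtx; eauto.
Qed.

Lemma adj_component n u y : adj E (pair n u) y -> exists w, y = pair n w.
Proof.
  rewrite E_arc. intros [H|H]; apply arc_component in H;
    destruct H as [n' [u' [w' [E1 E2]]]].
  - apply pair_inj in E1. destruct E1 as [-> _]. eauto.
  - apply pair_inj in E2. destruct E2 as [-> _]. eauto.
Qed.

(* Within one component the colouring is definable: a truth value tells the colour
   of the right end. *)
Lemma D0_hue_0 n : D0 (fun r : env => hue (pair n (r 0%nat)) 0).
Proof.
  apply (D0_ext _ (fun r => (exists m z, r 0%nat = pair m z /\ z = numeral M 0) \/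
    (r 0%nat = pair 0 (numeral M d) \/
     (r 0%nat = pair 0 (numeral M (S d)) /\ exists m, pair n m ∈ X)))).
  - intros r. generalize (r 0%nat). clear r. intros u. split.
    + intros H. remember (pair n u) as x eqn:Ex. remember 0%nat as j eqn:Ej.
      destruct H; try discriminate; apply pair_inj in Ex; destruct Ex as [-> <-]; eauto.
    + intros [[m [z [-> ->]]]|[->|[-> [m Hm]]]].
      * apply (hue_clique n m 0). lia.
      * apply (hue_left n).
      * apply (hue_right_X n m Hm).
  - d0.
Qed.

(** With two hues, exactly one of two adjacent vertices has hue 0, so the vertices at even positions
    agree with the first one. The last position [(1 + 1) * k] is even, yet its vertex is adjacent to
    the first. *)
Lemma no_odd_cycle : d = 2%nat -> ~ has_odd_cycle V E.
Proof.
  intros Hd [v [l [[k Ek] [[Hv Htot] [_ [Hstep [k' [x0 [x1 [Ek' [H0 [H1 Hlast]]]]]]]]]]]].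
  assert (k' = (1 + 1) * k).
  { apply (add_cancel_r _ _ 1). congruence. }
  subst k' l. clear Ek'.
  assert (Hflip : forall x y, adj E x y -> (hue x 0 <-> ~ hue y 0)).
  { intros x y Hxy. split; [intros Hx Hy; exact (adj_hue_proper _ _ _ Hxy Hx Hy)|].
    intros Hy. destruct (adj_hue _ _ Hxy) as [i [Hi Hx]].
    destruct (adj_hue _ _ (adj_sym _ _ Hxy)) as [j [Hj Hyj]].
    destruct j as [|j]; [tauto|]. destruct i as [|i]; [exact Hx|].
    destruct (adj_hue_proper x y 1 Hxy); [replace 1%nat with (S i) by lia |
      replace 1%nat with (S j) by lia]; auto. }
  (* Fixing [n] makes hue 0 a bounded condition in the induction below; adjacency keeps the cycle in
     this component. *)
  assert (exists n u0 u1, x0 = pair n u0 /\ x1 = pair n u1) as [n [u0 [u1 [-> ->]]]].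
  { apply E_arc in Hlast. destruct Hlast as [H|H]; apply arc_component in H;
      destruct H as [n [u [w [E1 E2]]]]; eauto. }
  assert (Hex : forall i, i < (1 + 1) * k + 1 -> exists x, maps v i x).
  { intros i Hi. destruct (Htot i Hi) as [x [Hx _]]. eauto. }
  assert (Hk : forall i, exists w, i <= k ->
    maps v (i + i) (pair n w) /\ (hue (pair n w) 0 <-> hue (pair n u0) 0)).
  { s1_induction.
    - apply S1_ex_D0. unfold maps, iff. d0;
        apply (D0_comp1 (fun w => hue (pair n w) 0)); solve [apply D0_hue_0 | tm].
    - exists u0. intros _. rewrite add_0_r. tauto.
    - intros i [w Hw].
      destruct (classic (i + 1 <= k)) as [Hi|Hi]; [|exists 0; tauto].
      destruct Hw as [Hw Hh]; [left; apply lt_le_succ, Hi|].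
      apply le_iff_add in Hi. destruct Hi as [t Ht].
      destruct (Hex (i + i + 1)) as [y Hy].
      { rewrite Ht. apply lt_iff_add. exists (t + t + 1). ring. }
      destruct (Hex (i + i + 1 + 1)) as [y' Hy'].
      { rewrite Ht. apply lt_iff_add. exists (t + t). ring. }
      pose proof (Hstep _ _ _ Hw Hy) as A. pose proof (Hstep _ _ _ Hy Hy') as A'.
      destruct (adj_component _ _ _ A) as [w1 ->].
      destruct (adj_component _ _ _ A') as [w2 ->].
      exists w2. intros _. replace (i + 1 + (i + 1)) with (i + i + 1 + 1) by ring.
      split; [exact Hy'|]. apply Hflip in A, A'. tauto. }
  destruct (Hk k) as [w Hw]. destruct Hw as [Hw Hh]; [auto|].
  assert (pair n w = pair n u1) as Ew.
  { destruct (Htot (k + k)) as [x [_ Hx]].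
    - apply lt_iff_add. exists 0. ring.
    - rewrite <- (Hx _ Hw). apply Hx. replace (k + k) with ((1 + 1) * k) by ring. exact H1. }
  rewrite Ew in Hh. apply Hflip in Hlast. tauto.
Qed.

(** Together with [u] and [v] the [d - 1] clique vertices make [d + 1] places for [d] colours. Two
    places share a colour, and any two other than those of [u] and [v] hold adjacent vertices. *)
Lemma colour_transfer c n m u v i j :
  is_function c (fun x => x ∈ V) (fun i => i < numeral M d) ->
  (forall x y i j, adj E x y -> maps c x i -> maps c y j -> i <> j) ->
  stage n m ->
  (forall k, (0 < k < d)%nat -> adj E u (vtx n m k)) ->
  (forall k, (0 < k < d)%nat -> adj E v (vtx n m k)) ->
  maps c u i -> maps c v j -> i = j.
Proof.
  intros [Hc Htot] Hprop Hst Hu Hv Hi Hj.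
  set (x k := if Nat.eqb k 0 then u else if Nat.eqb k d then v else vtx n m k).
  assert (x_in : forall k, (0 < k < d)%nat -> x k = vtx n m k).
  { intros k Hk. unfold x. destruct (Nat.eqb_spec k 0); [lia|].
    destruct (Nat.eqb_spec k d); [lia | reflexivity]. }
  assert (x_0 : x 0%nat = u) by reflexivity.
  assert (x_d : x d = v).
  { unfold x. destruct (Nat.eqb_spec d 0); [lia|]. rewrite Nat.eqb_refl. reflexivity. }
  destruct (pigeonhole (fun k t => maps c (x k) (numeral M t)) d)
    as [k [k' [t [Hk [H1 H2]]]]].
  - intros k _. destruct (Htot (x k) (V_all _)) as [t [Ht _]].
    destruct (Hc _ Ht) as [y [t' [Et [_ Hlt]]]]. apply pair_inj in Et.
    destruct Et as [_ ->]. apply lt_numeral in Hlt. destruct Hlt as [s [Hs ->]]. eauto.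
  - destruct (Nat.eq_dec k 0) as [->|Hk0]; destruct (Nat.eq_dec k' d) as [->|Hkd].
    + rewrite x_0 in H1. rewrite x_d in H2.
      destruct (Htot u (V_all _)) as [a [_ Ha]]. destruct (Htot v (V_all _)) as [b [_ Hb]].
      rewrite <- (Ha _ Hi), <- (Hb _ Hj), (Ha _ H1), (Hb _ H2). reflexivity.
    + exfalso. apply (Hprop (x 0%nat) (x k') (numeral M t) (numeral M t)); auto.
      rewrite x_0, x_in by lia. apply Hu. lia.
    + exfalso. apply (Hprop (x d) (x k) (numeral M t) (numeral M t)); auto.
      rewrite x_d, x_in by lia. apply Hv. lia.
    + exfalso. apply (Hprop (x k) (x k') (numeral M t) (numeral M t)); auto.
      rewrite !x_in by lia. apply E_arc. left. apply arc_clique; try lia.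
      destruct Hst as [H|H]; [left | right]; auto. repeat split; auto; lia.
Qed.

Lemma gadget_separates : colorable V E (numeral M d) ->
  exists S : sets M, forall n m,
    (pair n m ∈ X -> n ∈ S) /\ (pair n m ∈ Y -> ~ n ∈ S).
Proof.
  intros [c [Hc Hprop]].
  destruct (D0_comprehension (fun n => exists i, i < numeral M d /\
    (maps c (left_end n) i /\ maps c (right_end n) i))) as [S HS].
  { unfold left_end, right_end, vtx, maps. d0. }
  pose proof (proj2 Hc) as Htot.
  exists S. intros n m. rewrite HS.
  destruct (Htot (left_end n) (V_all _)) as [i [Hi _]].
  destruct (Htot (right_end n) (V_all _)) as [j [Hj Hju]].
  split; intros H.
  - assert (i = j) as <-.
    { apply (colour_transfer c n m (left_end n) (right_end n)); auto; [left; exact H| |];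
        intros k Hk; apply E_arc; left.
      - apply arc_left; [exact Hk | left; exact H].
      - apply arc_right; [lia|]. left. split; [exact H | lia]. }
    exists i. split; [|auto].
    destruct (proj1 Hc _ Hi) as [x [i' [Ei [_ K]]]]. apply pair_inj in Ei.
    destruct Ei as [_ ->]. exact K.
  - intros [i' [_ [Hi' Hj']]].
    destruct (Htot (vtx n m 0) (V_all _)) as [t [Ht _]].
    assert (i' = t) as ->.
    { apply (colour_transfer c n m (left_end n) (vtx n m 0)); auto; [right; exact H| |];
        intros k Hk; apply E_arc; left.
      - apply arc_left; [exact Hk | right; exact H].
      - apply arc_clique; auto; lia. }
    apply (Hprop (right_end n) (vtx n m 0) t t); auto.
    apply E_arc. left. apply arc_right; [lia | auto].
Qed.

Lemma adj_end n i y : (d <= i)%nat -> adj E (vtx n 0 i) y ->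
  exists m j, (j < d)%nat /\ stage n m /\ y = vtx n m j.
Proof.
  intros Hi. rewrite E_arc. intros [H|H]; remember (vtx n 0 i) as x eqn:Ex;
    destruct H as [n' m' i' j Hi' Hj Hij H | n' m' j Hj H | n' m' j Hj H];
    apply vtx_inj in Ex; try lia; destruct Ex as [-> _].
  - exists m', j. split; [lia | auto].
  - exists m', j. split; [lia|]. split; [unfold stage; tauto | reflexivity].
Qed.

Lemma adj_clique n m i y : (i < d)%nat -> (adj E (vtx n m i) y <->
  (exists j, (j < d)%nat /\ i <> j /\
     (pair n m ∈ X /\ i <> 0%nat /\ j <> 0%nat \/ pair n m ∈ Y) /\ y = vtx n m j) \/
  (i <> 0%nat /\ stage n m /\ y = left_end n) \/
  ((pair n m ∈ X /\ i <> 0%nat \/ pair n m ∈ Y /\ i = 0%nat) /\ y = right_end n)).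
Proof.
  intros Hi. rewrite E_arc. split.
  - intros [H|H]; remember (vtx n m i) as x eqn:Ex;
      destruct H as [n' m' i' j Hi' Hj Hij H | n' m' j Hj H | n' m' j Hj H];
      apply vtx_inj in Ex; try lia; destruct Ex as [-> [-> <-]].
    + left. exists j. auto.
    + left. exists i'. split; [exact Hi'|]. split; [auto|]. split; [tauto | reflexivity].
    + right. left. split; [lia | auto].
    + right. right. auto.
  - intros [[j [Hj [Hij [H ->]]]]|[[Hi0 [H ->]]|[H ->]]].
    + left. apply arc_clique; auto.
    + right. apply arc_left; [lia | exact H].
    + right. apply arc_right; auto.
Qed.

Lemma adj_vertex x y : adj E x y ->
  (exists n m i, (i < d)%nat /\ x = vtx n m i) \/
  (exists n i, (d <= i)%nat /\ x = vtx n 0 i).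
Proof.
  rewrite E_arc. intros [H|H]; destruct H; try (left; eauto 6; fail).
  - right. exists n, d. auto.
  - right. exists n, (S d). auto.
  - left. exists n, m, j. split; [lia | reflexivity].
Qed.

Lemma stage_unique n m m' : stage n m -> stage n m' -> m = m'.
Proof.
  intros [H|H] [H'|H']; eauto; exfalso; eapply X_Y_disjoint; eauto.
Qed.

(** In the case of [X] a clique vertex of nonzero index sees [d - 2] others and both ends; in the
    case of [Y] a clique vertex sees [d - 1] others and one end. All neighbours of an end belong to
    a single stage, by [stage_unique]. *)
Lemma neighbours_cover x : exists l, (length l <= d)%nat /\ forall y, adj E x y -> In y l.
Proof.
  destruct (classic (exists y, adj E x y)) as [[y0 H0]|H0].
  2: { exists []. split; [simpl; lia|]. intros y H. apply H0. eauto. }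
  destruct (adj_vertex _ _ H0) as [[n [m [i [Hi ->]]]]|[n [i [Hi ->]]]].
  - assert (Hrem : (length (remove Nat.eq_dec i (seq 0 d)) < d)%nat).
    { rewrite <- (length_seq d 0) at 2. apply remove_length_lt, in_seq. lia. }
    assert (Hrem1 : i <> 0%nat ->
      (length (remove Nat.eq_dec i (seq 1 (d - 1))) < d - 1)%nat).
    { intros H. rewrite <- (length_seq (d - 1) 1) at 2. apply remove_length_lt, in_seq. lia. }
    destruct (classic (pair n m ∈ X)) as [HX|HX].
    + assert (HY := X_Y_disjoint _ _ m HX).
      destruct (Nat.eq_dec i 0) as [->|Hi0].
      * exists []. split; [simpl; lia|]. intros y H. apply adj_clique in H; [|lia].
        destruct H as [[j H]|[H|[H _]]]; tauto.
      * exists (right_end n :: left_end n ::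
          map (vtx n m) (remove Nat.eq_dec i (seq 1 (d - 1)))). split.
        -- simpl. rewrite length_map. specialize (Hrem1 Hi0). lia.
        -- intros y H. apply adj_clique in H; [|lia].
           destruct H as [[j [Hj [Hij [[[_ [_ Hj0]]|H] ->]]]]|[[_ [_ ->]]|[_ ->]]];
             [|tauto|right; left; reflexivity|left; reflexivity].
           right. right. apply in_map, in_in_remove; [auto|]. apply in_seq. lia.
    + destruct (Nat.eq_dec i 0) as [->|Hi0].
      * exists (right_end n :: map (vtx n m) (remove Nat.eq_dec 0%nat (seq 0 d))). split.
        -- simpl. rewrite length_map. lia.
        -- intros y H. apply adj_clique in H; [|lia].
           destruct H as [[j [Hj [Hij [_ ->]]]]|[[H _]|[_ ->]]];
             [|tauto|left; reflexivity].
           right. apply in_map, in_in_remove; [auto|]. apply in_seq. lia.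
      * exists (left_end n :: map (vtx n m) (remove Nat.eq_dec i (seq 0 d))). split.
        -- simpl. rewrite length_map. lia.
        -- intros y H. apply adj_clique in H; [|lia].
           destruct H as [[j [Hj [Hij [_ ->]]]]|[[_ [_ ->]]|[H _]]];
             [|left; reflexivity|tauto].
           right. apply in_map, in_in_remove; [auto|]. apply in_seq. lia.
  - destruct (adj_end _ _ _ Hi H0) as [m [j [_ [Hm _]]]].
    exists (map (vtx n m) (seq 0 d)). split; [rewrite length_map, length_seq; lia|].
    intros y H. destruct (adj_end _ _ _ Hi H) as [m' [j' [Hj' [Hm' ->]]]].
    rewrite (stage_unique _ _ _ Hm' Hm). apply in_map, in_seq. lia.
Qed.

(** The maximum [d] must be attained. Index 1 is available because [d >= 2], and it belongs to the
    clique in both cases; the neighbour [z] is what distinguishes them. *)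
Lemma degree_clique n m : stage n m -> degree E (vtx n m 1) (numeral M d).
Proof.
  intros Hst.
  assert (exists z, (pair n m ∈ X /\ z = right_end n) \/
                    (pair n m ∈ Y /\ z = vtx n m 0)) as [z Hz].
  { destruct Hst; eauto. }
  set (l := z :: left_end n :: map (vtx n m) (seq 2 (d - 2))).
  replace d with (length l) by (simpl; rewrite length_map, length_seq; lia).
  apply has_card_list.
  - assert (Hmap : forall k j, In (vtx n k j) (map (vtx n m) (seq 2 (d - 2))) ->
      (2 <= j < d)%nat).
    { intros k j H. apply in_map_iff in H. destruct H as [j' [H Hj']].
      apply vtx_inj in H. destruct H as [_ [_ <-]]. apply in_seq in Hj'. lia. }
    constructor; [|constructor].
    + intros [H|H].
      * destruct Hz as [[_ ->]|[_ ->]]; apply vtx_inj in H; lia.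
      * destruct Hz as [[_ ->]|[_ ->]]; apply Hmap in H; lia.
    + intros H. apply Hmap in H. lia.
    + apply Injective_map_NoDup; [|apply seq_NoDup].
      intros i j H. apply vtx_inj in H. tauto.
  - intros y. rewrite adj_clique by lia. split.
    + intros [[j [Hj [Hij [H ->]]]]|[[_ [_ ->]]|[H ->]]].
      * destruct (Nat.eq_dec j 0) as [->|Hj0].
        -- left. destruct Hz as [[HX ->]|[_ ->]]; [|reflexivity].
           destruct H as [H|H]; [tauto|]. destruct (X_Y_disjoint _ _ _ HX H).
        -- right. right. apply in_map, in_seq. lia.
      * right. left. reflexivity.
      * left. destruct Hz as [[_ ->]|[HY ->]]; [reflexivity|].
        destruct H as [[H _]|[_ H]]; [|discriminate].
        destruct (X_Y_disjoint _ _ _ H HY).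
    + intros [<-|[<-|H]].
      * destruct Hz as [[HX ->]|[HY ->]]; [right; right | left; exists 0%nat]; auto.
        repeat split; auto; lia.
      * right. left. auto.
      * apply in_map_iff in H. destruct H as [j [<- Hj]]. apply in_seq in Hj.
        left. exists j. split; [lia|]. split; [lia|]. split; [|reflexivity].
        destruct Hst as [H|H]; [left | right]; auto. repeat split; auto; lia.
Qed.

Lemma gadget_max_degree n m : stage n m -> max_degree V E (numeral M d).
Proof.
  intros H. split.
  - intros x _. destruct (neighbours_cover x) as [l [Hl Hx]].
    apply (has_card_cover _ l); auto.
  - exists (vtx n m 1). split; [apply V_all | apply (degree_clique _ _ H)].
Qed.

End Graph.

Lemma separation_first : BT d M -> exists S : sets M, forall n m,
  (pair n m ∈ X -> n ∈ S) /\ (pair n m ∈ Y -> ~ n ∈ S).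
Proof.
  intros HBT.
  destruct (classic (exists n m, stage n m)) as [[n [m Hst]]|Hst].
  (* Without any enumerated number the graph has no edges and its maximum degree is not [d]; then
     any set separates. *)
  2: { destruct (D0_comprehension (fun _ : nums M => True)) as [S HS]; [d0|].
    exists S. intros n m. split; intros H; destruct Hst; exists n, m;
      [left | right]; exact H. }
  destruct gadget_exists as [V [E [HV [HEp HE]]]].
  apply (gadget_separates V E HV HE).
  assert (HG : is_graph V E).
  { split; [exists 0; apply HV|]. split; [|split].
    - intros z Hz. destruct (HEp z Hz) as [x [y ->]]. exists x, y. auto.
    - intros x y. apply (adj_sym E HE).
    - intros x. apply (adj_irrefl E HE). }
  pose proof (gadget_max_degree V E HV HE n m Hst) as Hdeg.
  unfold BT in HBT. destruct (Nat.eqb_spec d 2) as [Hd|Hd].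
  - pose proof (no_odd_cycle V E HE Hd) as Hodd. rewrite Hd in Hdeg |- *.
    apply HBT; assumption.
  - apply HBT; [assumption | assumption | apply no_clique; assumption].
Qed.
End Gadget.

Section Separation.
Context {M : L2structure} {HM : model M}.

(** Keeping only the least stage of each number preserves which numbers are enumerated and gives the
    uniqueness on which the degree bound rests. *)
Lemma first_stages (X : sets M) : exists X' : sets M,
  (forall n m, pair n m ∈ X' -> pair n m ∈ X) /\
  (forall n m m', pair n m ∈ X' -> pair n m' ∈ X' -> m = m') /\
  (forall n m, pair n m ∈ X -> exists m', pair n m' ∈ X').
Proof.
  destruct (D0_comprehension (fun z : nums M => exists n m, z = pair n m /\
    (pair n m ∈ X /\ forall k, k < m -> ~ pair n k ∈ X))) as [X' HX]; [d0|].
  assert (H : forall n m, pair n m ∈ X' <->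
    pair n m ∈ X /\ forall k, k < m -> ~ pair n k ∈ X).
  { intros n m. rewrite HX. split; [|intros K; exists n, m; auto].
    intros [n' [m' [E K]]]. apply pair_inj in E. destruct E as [-> ->]. exact K. }
  exists X'. split; [|split].
  - intros n m K. apply H, K.
  - intros n m m' K K'. apply H in K, K'. destruct K as [K Kl], K' as [K' Kl'].
    destruct (lt_total m m') as [L|[L|L]]; [|exact L|]; exfalso.
    + exact (Kl' _ L K).
    + exact (Kl _ L K').
  - intros n m K. destruct (least (fun m => pair n m ∈ X)) with (n := m)
      as [m' [_ [K' Kl]]]; [d0 | exact K|].
    exists m'. apply H. auto.
Qed.

Lemma separation d (X Y : sets M) : (2 <= d)%nat -> BT d M ->
  (forall n m m', pair n m ∈ X -> ~ pair n m' ∈ Y) ->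
  exists S : sets M, forall n m,
    (pair n m ∈ X -> n ∈ S) /\ (pair n m ∈ Y -> ~ n ∈ S).
Proof.
  intros Hd HBT Hdisj.
  destruct (first_stages X) as [X' [X1 [X2 X3]]].
  destruct (first_stages Y) as [Y' [Y1 [Y2 Y3]]].
  destruct (separation_first d Hd X' Y' X2 Y2) as [S HS]; [|exact HBT|].
  { intros n m m' H H'. exact (Hdisj _ _ _ (X1 _ _ H) (Y1 _ _ H')). }
  exists S. intros n m. split; intros H.
  - destruct (X3 _ _ H) as [m' K]. exact (proj1 (HS n m') K).
  - destruct (Y3 _ _ H) as [m' K]. exact (proj2 (HS n m') K).
Qed.
End Separation.

(** * Paths through binary trees *)

Section SequenceDefinability.
Context {M : L2structure} {HM : model M}.
Notation env := (nat -> nums M).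

Lemma D0_finset_code f : Tm f -> D0 (fun r : env => finset_code (f r)).
Proof.
  apply D0_comp1.
  apply (D0_ext _ (fun r => forall c', c' < r 0%nat ->
    ~ (forall i, i < c' + r 0%nat -> (code_mem i c' <-> code_mem i (r 0%nat))))).
  - intros r. unfold finset_code.
    split; intros H c' Hc' K; apply (H c' Hc'), same_members_bounded, K.
  - unfold iff. d0.
Qed.
#[local] Hint Extern 2 (D0 _) => apply D0_finset_code; solve [tm] : d0.

Lemma has_length_le (s l : nums M) : has_length s l -> l <= s.
Proof.
  intros H. apply le_not_lt. intros K. apply H in K. destruct K as [j Hj].
  apply entry_lt in Hj. apply (lt_irrefl s), Hj.
Qed.

Lemma D0_seq_code f : Tm f -> D0 (fun r : env => seq_code (f r)).
Proof.
  apply D0_comp1.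
  apply (D0_ext _ (fun r => finset_code (r 0%nat) /\
    (forall z, z < r 0%nat -> code_mem z (r 0%nat) ->
       exists i j, z = pair i j /\ True) /\
    (forall i, i < r 0%nat -> forall j, j < r 0%nat -> forall k, k < r 0%nat ->
       entry (r 0%nat) i j -> entry (r 0%nat) i k -> j = k) /\
    (exists l, l < r 0%nat + 1 /\ has_length (r 0%nat) l))).
  - intros r. generalize (r 0%nat). clear r. intros s. unfold seq_code. split.
    + intros [Hs [Hp [Hf [l Hl]]]]. split; [exact Hs|]. split; [|split].
      * intros z _ Hz. destruct (Hp z Hz) as [i [j E]]. eauto.
      * intros i _ j _ k _. apply Hf.
      * exists l. split; [apply lt_S_iff, has_length_le, Hl | exact Hl].
    + intros [Hs [Hp [Hf [l [_ Hl]]]]]. split; [exact Hs|]. split; [|split].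
      * intros z Hz. destruct (Hp z (code_mem_lt _ _ Hz) Hz) as [i [j [E _]]]. eauto.
      * intros i j k Hj Hk. destruct (entry_lt _ _ _ Hj), (entry_lt _ _ _ Hk).
        apply (Hf i); auto.
      * eauto.
  - d0.
Qed.
#[local] Hint Extern 2 (D0 _) => apply D0_seq_code; solve [tm] : d0.

Lemma D0_binary_seq f : Tm f -> D0 (fun r : env => binary_seq (f r)).
Proof.
  apply D0_comp1.
  apply (D0_ext _ (fun r => seq_code (r 0%nat) /\ forall i, i < r 0%nat ->
    forall j, j < r 0%nat -> entry (r 0%nat) i j -> j = 0 \/ j = 1)).
  - intros r. unfold binary_seq. split; intros [H K]; split; eauto.
    intros i j Hj. destruct (entry_lt _ _ _ Hj). apply (K i); auto.
  - d0.
Qed.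
End SequenceDefinability.

#[export] Hint Extern 2 (D0 _) => apply D0_finset_code; solve [tm] : d0.
#[export] Hint Extern 2 (D0 _) => apply D0_seq_code; solve [tm] : d0.
#[export] Hint Extern 2 (D0 _) => apply D0_binary_seq; solve [tm] : d0.
#[export] Hint Extern 2 (D0 _) => apply D0_moduli_base; solve [tm] : d0.

Section Tree.
Context {M : L2structure} {HM : model M}.
Notation env := (nat -> nums M).
Variable T : sets M.
Hypothesis HT : binary_tree T.
Hypothesis T_infinite : infinite T.

Lemma zero_neq_one : (0 : nums M) <> 1.
Proof. rewrite <- (add_0_l 1). intros E. apply (succ_neq_0 (M := M) 0). auto. Qed.

Lemma tree_binary u : u ∈ T -> binary_seq u.
Proof. apply HT. Qed.

Lemma tree_closed u t : u ∈ T -> seq_code t -> initial_segment t u -> t ∈ T.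
Proof. apply HT. Qed.

Lemma entry_unique (u i j k : nums M) : seq_code u -> entry u i j -> entry u i k -> j = k.
Proof. intros [_ [_ [H _]]]. apply H. Qed.

(** [infinite] speaks of codes, not of lengths. If level [m] were empty, closure under initial
    segments would make all lengths smaller than [m], and the codes of such binary sequences are
    bounded. *)
Lemma level_nonempty m : exists u, u ∈ T /\ has_length u m.
Proof.
  apply NNPP. intros C. apply T_infinite.
  destruct (moduli_base_exists (pair m 1)) as [p [N Hb]].
  exists (pair (pair m 1) (pair p N) + 1). intros u Hu. apply lt_S_iff.
  destruct (tree_binary u Hu) as [Hs Hbin]. destruct (proj2 (proj2 (proj2 Hs))) as [l Hl].
  apply (binary_seq_bounded m p N u l Hb (tree_binary u Hu) Hl).
  apply le_not_lt. intros Hml. apply C.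
  destruct (seq_restrict u l m Hs Hl) as [t [Ht [Htl Hte]]]; [auto|].
  exists t. split; [|exact Htl]. apply (tree_closed u); auto.
  intros i j Hij. apply Hte, Hij.
Qed.

(* The complement is [Sigma^0_1] because a [moduli_base] bounds the codes of the
   binary sequences of length [m]. *)
Lemma level_set (Q : nums M -> nums M -> Prop) :
  D0 (fun r : env => Q (r 0%nat) (r 1%nat)) ->
  exists R : sets M, forall x m,
    pair x m ∈ R <-> exists u, u ∈ T /\ has_length u m /\ Q x u.
Proof.
  intros HQ.
  destruct (S1_comprehension (fun z => exists x m u, z = pair x m /\
      (u ∈ T /\ has_length u m /\ Q x u))) as [R HR].
  - repeat apply S1_ex. apply S1_D0. d0. apply (D0_comp2 Q); [exact HQ | tm | tm].
  - apply (S1_ext _ (fun r : env => exists p N,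
      ~ (exists x m, r 0%nat = pair x m /\ True) \/
      (exists x m, r 0%nat = pair x m /\ (moduli_base (pair m 1) p N /\
         forall u, u < pair (pair m 1) (pair p N) + 1 ->
           ~ (u ∈ T /\ has_length u m /\ Q x u))))).
    + intros r. generalize (r 0%nat). clear r. intros z. split.
      * intros C. destruct (classic (exists x m, z = pair x m /\ True)) as [K|K].
        -- destruct K as [x [m [-> _]]].
           destruct (moduli_base_exists (pair m 1)) as [p [N Hb]].
           exists p, N. right. exists x, m. split; [reflexivity|]. split; [exact Hb|].
           intros u _ Hu. apply C. exists x, m, u. auto.
        -- exists 0, 0. auto.
      * intros [p [N [K|K]]] [x [m [u [-> Hu]]]]; [apply K; eauto|].
        destruct K as [x' [m' [E [Hb K]]]]. apply pair_inj in E. destruct E as [<- <-].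
        apply (K u); [|exact Hu]. apply lt_S_iff.
        apply (binary_seq_bounded m p N u m Hb); [apply tree_binary|..]; tauto.
    + repeat apply S1_ex. apply S1_D0. d0. apply (D0_comp2 Q); [exact HQ | tm | tm].
  - exists R. intros x m. rewrite HR. split.
    + intros [x' [m' [u [E H]]]]. apply pair_inj in E. destruct E as [-> ->]. eauto.
    + intros [u H]. exists x, m, u. auto.
Qed.

(** The bound [l < u] follows from the entry at [l] and makes this a bounded formula. *)
Definition extends_by (b t u : nums M) : Prop :=
  initial_segment t u /\ exists l, l < u /\ has_length t l /\ entry u l b.

Lemma D0_extends_by b : D0 (fun r : env => extends_by b (r 0%nat) (r 1%nat)).
Proof. unfold extends_by. d0. Qed.

(** * The greedy path that follows a separating set *)

Section Branching.
Variables R R0 R1 S : sets M.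
Hypothesis R_spec : forall t m,
  pair t m ∈ R <-> exists u, u ∈ T /\ has_length u m /\ initial_segment t u.
Hypothesis R0_spec : forall t m,
  pair t m ∈ R0 <-> exists u, u ∈ T /\ has_length u m /\ extends_by 0 t u.
Hypothesis R1_spec : forall t m,
  pair t m ∈ R1 <-> exists u, u ∈ T /\ has_length u m /\ extends_by 1 t u.
(** Membership in [S] means continuing with 0. It is prescribed only where one of the two extensions
    dies out before the other. *)
Hypothesis S_0 : forall t m, pair t m ∈ R0 -> ~ pair t m ∈ R1 -> t ∈ S.
Hypothesis S_1 : forall t m, pair t m ∈ R1 -> ~ pair t m ∈ R0 -> ~ t ∈ S.

(* [w] bounds the codes of the initial segments, which may exceed that of [s]; it
   keeps the formula bounded. *)
Definition greedy (n s w : nums M) : Prop :=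
  binary_seq s /\ has_length s n /\
  forall i, i < n -> exists t, t < w /\
    (seq_code t /\ has_length t i /\ initial_segment t s /\ (entry s i 0 <-> t ∈ S)).

Lemma D0_greedy f g h : Tm f -> Tm g -> Tm h ->
  D0 (fun r : env => greedy (f r) (g r) (h r)).
Proof.
  intros Hf Hg Hh.
  assert (Hg' := Tm_subst_S _ Hg). assert (Hh' := Tm_subst_S _ Hh).
  assert (Hg'' := Tm_subst_S _ Hg').
  unfold greedy, iff. apply D0_and; [apply D0_binary_seq, Hg|].
  apply D0_and; [apply D0_has_length; assumption|].
  apply D0_all; [exact Hf|]. apply D0_ex; [exact Hh'|].
  apply D0_and; [d0|]. apply D0_and; [d0|].
  apply D0_and; [apply D0_initial_segment; [tm | exact Hg'']|].
  apply D0_and; apply D0_imp; try d0; apply D0_entry; solve [exact Hg'' | tm].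
Qed.

Lemma greedy_exists n : exists s w, greedy n s w.
Proof.
  revert n. s1_induction.
  - apply S1_ex, S1_ex, S1_D0, D0_greedy; tm.
  - destruct (empty_seq (M := M)) as [s [Hs [Hl He]]]. exists s, 0.
    split; [split; [exact Hs|]|split; [exact Hl|]].
    + intros i j H. destruct (He _ _ H).
    + intros i Hi. destruct (lt_irrefl_0 _ Hi).
  - intros n [s [w [[Hs Hbin] [Hl Hi]]]].
    assert (Hnew : forall j, ~ entry s n j).
    { intros j Hj. apply (lt_irrefl n), Hl. eauto. }
    assert (exists b : nums M, (b = 0 \/ b = 1) /\ (b = 0 <-> s ∈ S)) as [b [Hb HbS]].
    { destruct (classic (s ∈ S)); [exists 0; tauto|].
      exists 1. split; [auto|]. split; [|tauto]. intros E. destruct zero_neq_one. auto. }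
    destruct (seq_extend s n b Hs Hl) as [s' [Hs' [Hl' He']]].
    (* The new bound exceeds [s], the initial segment that decided the new bit, and is large enough
       for all earlier ones. *)
    exists s', (w + s + 1). split; [split; [exact Hs'|]|split; [exact Hl'|]].
    + intros i j H. apply He' in H. destruct H as [H|[_ ->]]; [eauto | exact Hb].
    + intros i Hin. apply lt_S_iff in Hin. destruct Hin as [Hin| ->].
      * destruct (Hi i Hin) as [t [Ht [Hst [Htl [Hts HtS]]]]]. exists t. split.
        { eapply lt_le_trans; [exact Ht|]. apply le_iff_add. exists (s + 1).
          apply eq_sym, add_assoc. }
        split; [exact Hst|]. split; [exact Htl|]. split.
        -- intros a c H. apply He'. left. apply Hts, H.
        -- rewrite He', <- HtS. split; [|auto]. intros [H|[-> _]]; [exact H|].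
           destruct (lt_irrefl _ Hin).
      * exists s. split; [apply lt_S_iff, le_add_l|].
        split; [exact Hs|]. split; [exact Hl|]. split.
        -- intros a c H. apply He'. auto.
        -- rewrite He', <- HbS. split.
           ++ intros [H|[_ H]]; [destruct (Hnew _ H) | auto].
           ++ auto.
Qed.

Lemma greedy_bit n s w i : greedy n s w -> i < n ->
  exists b, entry s i b /\ (b = 0 \/ b = 1).
Proof.
  intros [[_ Hbin] [Hl _]] Hi. apply Hl in Hi. destruct Hi as [b Hb]. eauto.
Qed.

(** Agreement below [k] gives the initial segments of length [k] the same members, so by uniqueness
    of least codes they are the same number. Both sequences then consult [S] at the same node. *)
Lemma greedy_agree n s w n' s' w' : greedy n s w -> greedy n' s' w' ->
  forall i, i < n -> i < n' -> (entry s i 0 <-> entry s' i 0).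
Proof.
  intros G G'.
  enough (K : forall k i, i < k -> i < n -> i < n' -> (entry s i 0 <-> entry s' i 0)).
  { intros i. apply (K (i + 1)), lt_succ_diag. }
  d0_induction.
  - unfold iff. d0.
  - intros i Hi. destruct (lt_irrefl_0 _ Hi).
  - intros k IH i Hi Hn Hn'. apply lt_S_iff in Hi. destruct Hi as [Hi| ->]; [auto|].
    destruct (proj2 (proj2 G) k Hn) as [t [_ [Ht [Htl [Hts HtS]]]]].
    destruct (proj2 (proj2 G') k Hn') as [t' [_ [Ht' [Htl' [Hts' HtS']]]]].
    assert (Hall : forall i, i < k -> forall b, entry s i b <-> entry s' i b).
    { intros i Hi b. assert (Hin : i < n) by eauto using lt_trans.
      assert (Hin' : i < n') by eauto using lt_trans.
      destruct (greedy_bit _ _ _ _ G Hin) as [c [Hc Hc01]].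
      destruct (greedy_bit _ _ _ _ G' Hin') as [c' [Hc' Hc01']].
      assert (E : c = c').
      { pose proof (IH i Hi Hin Hin') as E.
        destruct Hc01 as [-> | ->], Hc01' as [-> | ->]; auto.
        - apply (entry_unique s' i); [apply G' | tauto | tauto].
        - apply (entry_unique s i); [apply G | tauto | tauto]. }
      subst c'. split; intros H.
      - replace b with c; [exact Hc'|]. apply (entry_unique s i); [apply G | |]; auto.
      - replace b with c; [exact Hc|]. apply (entry_unique s' i); [apply G' | |]; auto. }
    assert (Hsub : forall t t' s s', seq_code s' -> has_length t k -> has_length t' k ->
      initial_segment t s -> initial_segment t' s' ->
      (forall i, i < k -> forall b, entry s i b -> entry s' i b) ->
      forall i b, entry t i b -> entry t' i b).
    { clear. intros t t' s s' Hs' Hl Hl' Hts Hts' H i b Hib.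
      assert (Hi : i < k) by (apply Hl; eauto).
      assert (Hi' := Hi). apply Hl' in Hi'. destruct Hi' as [c Hc].
      replace b with c; [exact Hc|]. apply (entry_unique s' i); auto. }
    assert (E : t = t').
    { apply finset_code_unique; [apply Ht | apply Ht' |]. intros z. split; intros Hz.
      - destruct (proj1 (proj2 Ht) z Hz) as [i [b ->]].
        apply (Hsub t t' s s'); auto; [apply G' | apply Hall].
      - destruct (proj1 (proj2 Ht') z Hz) as [i [b ->]].
        apply (Hsub t' t s' s); auto; [apply G |]. intros a Ha c. apply Hall, Ha. }
    subst t'. rewrite HtS, HtS'. tauto.
Qed.

(** The invariant, extensions of the current node at all levels, is Pi^0_1. If the chosen extension
    were missing at level [m], the other one would be present there, and [S] would have chosen
    it. *)
Lemma greedy_extendible n s w : greedy n s w -> forall i, i <= n ->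
  forall t, has_length t i -> initial_segment t s -> forall m, i <= m -> pair t m ∈ R.
Proof.
  intros G. match goal with |- forall i, @?P i => apply (S1_not_induction P) end.
  - apply (S1_ext _ (fun r : env => exists t m, r 0%nat <= n /\ has_length t (r 0%nat) /\
      initial_segment t s /\ r 0%nat <= m /\ ~ pair t m ∈ R)).
    + intros r. generalize (r 0%nat). clear r. intros i. split.
      * intros H. apply NNPP. intros C. apply H. intros Hi t Ht Hts m Hm.
        apply NNPP. intros K. apply C. exists t, m. auto.
      * intros [t [m [Hi [Ht [Hts [Hm K]]]]]] H. apply K; auto.
    + apply S1_ex, S1_ex, S1_D0. d0.
  - intros _ t Ht _ m _. apply R_spec. destruct (level_nonempty m) as [u [Hu Hul]].
    exists u. split; [exact Hu|]. split; [exact Hul|]. intros i j H.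
    assert (K : i < 0) by (apply Ht; eauto). destruct (lt_irrefl_0 _ K).
  - intros i IH Hi t' Ht' Hts' m Hm.
    assert (Him : i < m) by (apply lt_le_succ, Hm).
    assert (Hin : i < n) by (apply lt_le_succ, Hi).
    destruct (proj2 (proj2 G) i Hin) as [t [_ [Ht [Htl [Hts HtS]]]]].
    assert (HR : pair t m ∈ R) by (apply IH; auto).
    apply R_spec in HR. destruct HR as [v [Hv [Hvl Htv]]].
    assert (Hvb : pair t m ∈ R0 \/ pair t m ∈ R1).
    { assert (K := Him). apply Hvl in K. destruct K as [b Hb].
      assert (X : extends_by b t v).
      { split; [exact Htv|]. exists i. split; [apply (entry_lt _ _ _ Hb) | auto]. }
      destruct (proj2 (tree_binary v Hv) _ _ Hb) as [-> | ->];
        [left; apply R0_spec | right; apply R1_spec]; eauto. }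
    assert (exists b u, entry s i b /\ u ∈ T /\ has_length u m /\ extends_by b t u)
      as [b [u [Hb [Hu [Hul [Htu [l [_ [Hl Hub]]]]]]]]].
    { destruct (classic (t ∈ S)) as [K|K].
      - assert (H0 : pair t m ∈ R0).
        { apply NNPP. intros C. destruct Hvb; [tauto|]. apply (S_1 t m); auto. }
        apply R0_spec in H0. destruct H0 as [u Hu]. exists 0, u. tauto.
      - assert (H1 : pair t m ∈ R1).
        { apply NNPP. intros C. destruct Hvb; [|tauto]. apply K, (S_0 t m); auto. }
        apply R1_spec in H1. destruct H1 as [u Hu]. exists 1, u. split; [|exact Hu].
        destruct (greedy_bit _ _ _ _ G Hin) as [b [Hb [-> | ->]]]; tauto. }
    rewrite (has_length_unique _ _ _ Hl Htl) in Hub.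
    apply R_spec. exists u. split; [exact Hu|]. split; [exact Hul|]. intros a c Hac.
    assert (Ha : a < i + 1) by (apply Ht'; eauto).
    apply lt_S_iff in Ha. destruct Ha as [Ha| ->].
    + apply Htl in Ha. destruct Ha as [c' Hc']. replace c with c'; [apply Htu, Hc'|].
      apply (entry_unique s a); [apply G | |]; auto.
    + replace c with b; [exact Hub|]. apply (entry_unique s i); [apply G | |]; auto.
Qed.

Lemma greedy_in_tree n s w : greedy n s w -> s ∈ T.
Proof.
  intros G. assert (H : pair s n ∈ R).
  { apply (greedy_extendible n s w G n); auto; [apply G|]. intros i j K. exact K. }
  apply R_spec in H. destruct H as [u [Hu [_ Hsu]]].
  apply (tree_closed u); [exact Hu | apply G | exact Hsu].
Qed.

(** The union of the greedy sequences is Delta^0_1: a long enough one exists by [greedy_exists], and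
    all of them show the same bit by [greedy_agree]. *)
Lemma greedy_path : exists g, path T g.
Proof.
  destruct (S1_comprehension (fun n => exists s w, greedy (n + 1) s w /\ entry s n 0))
    as [Z HZ].
  - apply S1_ex, S1_ex, S1_D0, D0_and; [apply D0_greedy; tm | d0].
  - apply (S1_ext _ (fun r : env => exists s w,
      greedy (r 0%nat + 1) s w /\ ~ entry s (r 0%nat) 0)).
    + intros r. generalize (r 0%nat). clear r. intros n. split.
      * intros H. destruct (greedy_exists (n + 1)) as [s [w G]]. exists s, w.
        split; [exact G|]. intros K. apply H. eauto.
      * intros [s [w [G H]]] [s' [w' [G' H']]]. apply H.
        apply (greedy_agree _ _ _ _ _ _ G G' n); auto; apply lt_succ_diag.
    + apply S1_ex, S1_ex, S1_D0, D0_and; [apply D0_greedy; tm | d0].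
  - assert (HZ' : forall n s w i, greedy n s w -> i < n -> (i ∈ Z <-> entry s i 0)).
    { intros n s w i G Hi. rewrite HZ. split.
      - intros [s' [w' [G' H]]].
        apply (greedy_agree _ _ _ _ _ _ G G' i); auto. apply lt_succ_diag.
      - intros H. destruct (greedy_exists (i + 1)) as [s' [w' G']]. exists s', w'.
        split; [exact G'|].
        apply (greedy_agree _ _ _ _ _ _ G' G i); auto. apply lt_succ_diag. }
    destruct (D0_comprehension (fun z : nums M => exists n j, z = pair n j /\
      (n ∈ Z /\ j = 0 \/ ~ n ∈ Z /\ j = 1))) as [g Hg]; [d0|].
    assert (Hm : forall n j, maps g n j <-> n ∈ Z /\ j = 0 \/ ~ n ∈ Z /\ j = 1).
    { intros n j. unfold maps. rewrite Hg. split; [|eauto].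
      intros [n' [j' [E H]]]. apply pair_inj in E. destruct E as [-> ->]. exact H. }
    exists g. split; [split|].
    + intros z Hz. apply Hg in Hz. destruct Hz as [n [j [-> H]]]. exists n, j.
      split; [reflexivity|]. tauto.
    + intros n _. destruct (classic (n ∈ Z)) as [K|K]; [exists 0 | exists 1];
        (split; [apply Hm; tauto|]); intros j Hj; apply Hm in Hj;
        destruct Hj as [[H ->]|[H ->]]; tauto.
    + intros n. destruct (greedy_exists n) as [s [w G]]. exists s.
      split; [exact (greedy_in_tree _ _ _ G)|]. split; [apply G|].
      intros i j Hij. apply Hm. assert (Hi : i < n) by (apply G; eauto).
      rewrite (HZ' _ _ _ _ G Hi).
      destruct (proj2 (proj1 G) _ _ Hij) as [-> | ->]; [auto|]. right.
      split; [|reflexivity]. intros H. apply zero_neq_one.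
      apply (entry_unique s i); [apply G | |]; auto.
Qed.
End Branching.

(** Cutting an extension down to length [m] keeps the bit at position [l] because [l < m]. Survival
    is thus downward closed in the level, so the levels at which two extensions die out can be
    compared. *)
Lemma level_restrict b R : (forall t m,
    pair t m ∈ R <-> exists u, u ∈ T /\ has_length u m /\ extends_by b t u) ->
  forall t l m m', has_length t l -> l < m -> m <= m' -> pair t m' ∈ R -> pair t m ∈ R.
Proof.
  intros HR t l m m' Hl Hlm Hm H. apply HR in H.
  destruct H as [u [Hu [Hul [Htu [l' [_ [Hl' Hb]]]]]]].
  rewrite (has_length_unique _ _ _ Hl' Hl) in Hb.
  destruct (seq_restrict u m' m (proj1 (tree_binary u Hu)) Hul Hm) as [v [Hv [Hvl Hve]]].
  apply HR. exists v. split; [|split; [exact Hvl|split]].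
  - apply (tree_closed u); auto. intros i j K. apply Hve, K.
  - intros i j K. apply Hve. split; [|apply Htu, K].
    eapply lt_trans; [|exact Hlm]. apply Hl. eauto.
  - exists l. assert (entry v l b) by (apply Hve; auto).
    split; [apply (entry_lt v l b); auto | auto].
Qed.

Lemma level_length b R : (forall t m,
    pair t m ∈ R <-> exists u, u ∈ T /\ has_length u m /\ extends_by b t u) ->
  forall t m, pair t m ∈ R -> exists l, has_length t l /\ l < m.
Proof.
  intros HR t m H. apply HR in H.
  destruct H as [u [Hu [Hul [_ [l [_ [Hl Hb]]]]]]]. exists l. split; [exact Hl|].
  apply Hul. eauto.
Qed.

Lemma tree_path d : (2 <= d)%nat -> BT d M -> exists g, path T g.
Proof.
  intros Hd HBT.
  destruct (level_set (fun t u => initial_segment t u)) as [R HR]; [d0|].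
  destruct (level_set (extends_by 0) (D0_extends_by 0)) as [R0 HR0].
  destruct (level_set (extends_by 1) (D0_extends_by 1)) as [R1 HR1].
  destruct (D0_comprehension (fun z => z ∈ R0 /\ ~ z ∈ R1)) as [X HX]; [d0|].
  destruct (D0_comprehension (fun z => z ∈ R1 /\ ~ z ∈ R0)) as [Y HY]; [d0|].
  destruct (separation d X Y Hd HBT) as [S HS].
  (* If each extension outlived the other, the one alive at the larger of the two levels would, by
     restriction, also be alive at the smaller one. *)
  - intros t m m' H H'. apply HX in H. apply HY in H'.
    destruct H as [H0 H1], H' as [H1' H0'].
    destruct (level_length 0 R0 HR0 _ _ H0) as [l [Hl Hlm]].
    destruct (level_length 1 R1 HR1 _ _ H1') as [l' [Hl' Hlm']].
    rewrite <- (has_length_unique _ _ _ Hl Hl') in Hlm'.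
    destruct (lt_total m m') as [K|[K|K]].
    + apply H1, (level_restrict 1 R1 HR1 t l m m'); auto.
    + subst m'. tauto.
    + apply H0', (level_restrict 0 R0 HR0 t l m' m); auto.
  - apply (greedy_path R R0 R1 S HR HR0 HR1).
    + intros t m H0 H1. apply (HS t m), HX. auto.
    + intros t m H1 H0. apply (HS t m), HY. auto.
Qed.
End Tree.

Local Close Scope L2_scope.

Theorem theorem3p6 :
  forall d : nat, 2 <= d -> implies_over RCA0 (BT d) WKL0.
Proof.
  intros d Hd M HM HBT. split; [exact HM|]. intros T HT Hinf.
  (* The tree itself is the set whose existence [model] demands. *)
  assert (model M) by (constructor; [exact HM | constructor; exact T]).
  exact (tree_path T HT Hinf d Hd HBT).
Qed.
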